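(* Let $s\in\mathbb{R}$, $u_0\in H^s(\mathbb{R}^d;\mathbb{R}^d)$ and $v_0\in H^{s-\alpha}(\mathbb{R}^d;\mathbb{R}^d)$. For $\delta>0$ let $u_\delta$ be the function with $\widehat{u_\delta(t,\cdot)}=\cos(\omega_\delta(\cdot)t)\hat u_0+\frac{\sin(\omega_\delta(\cdot)t)}{\omega_\delta(\cdot)}\hat v_0$ (the unique distributional solution in $C([0,\infty);H^s)\cap C^1((0,\infty);H^{s-\alpha})$ of the linear peridynamics model $\partial_{tt}u-K_\delta[u]=0$ with data $(u_0,v_0)$), and let $u$ be the function with $\widehat{u(t,\cdot)}=\cos(\gamma|\cdot|t)\hat u_0+\frac{\sin(\gamma|\cdot|t)}{\gamma|\cdot|}\hat v_0$ (the unique distributional solution in $C([0,\infty);H^s)\cap C^1((0,\infty);H^{s-1})$ of the wave equation $\partial_{tt}u-\gamma^2\Delta u=0$ with data $(u_0,v_0)$). Then for every $T\in[0,+\infty)$, $$\lim_{\delta\to0}\sup_{t\in[0,T]}\Big(\|u_\delta(t,\cdot)-u(t,\cdot)\|_{H^s(\mathbb{R}^d;\mathbb{R}^d)}+\|\partial_tu_\delta(t,\cdot)-\partial_tu(t,\cdot)\|_{H^{s-1}(\mathbb{R}^d;\mathbb{R}^d)}\Big)=0.$$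
   Context: Fix $d\ge1$, $\kappa\in(0,\infty)$, $\alpha\in(0,1)$, and $\chi\in L^\infty(\mathbb{R})$ with $\operatorname{supp}\chi\subset[-1,1]$, $0\le\chi\le1$, $\chi\equiv1$ on $[-\tfrac12,\tfrac12]$. For $\delta>0$ let $\chi_\delta(y)=\chi(|y|/\delta)$. $K_\delta[u](x)=-\frac{\kappa}{\delta^{2(1-\alpha)}}\,\mathrm{p.v.}\!\int\chi_\delta(y)\frac{u(x)-u(x-y)}{|y|^{d+2\alpha}}dy$. Fourier transform $\hat u(\xi)=(2\pi)^{-d/2}\int u(x)e^{-ix\cdot\xi}dx$, taken in $x$ for time-dependent functions. $\omega_\delta(\xi)=\big(\frac{\kappa}{\delta^{2(1-\alpha)}}\int_{\mathbb{R}^d}\chi_\delta(y)\frac{1-\cos(y\cdot\xi)}{|y|^{d+2\alpha}}dy\big)^{1/2}$, and $\sin(\omega_\delta t)/\omega_\delta$, $\sin(\gamma|\xi|t)/(\gamma|\xi|)$ equal $t$ at $\xi=0$. The constant $\gamma=\big(\frac{\kappa}{2}\mathcal L^d(B_1)\int_0^1\chi(\rho)\rho^{1-2\alpha}d\rho\big)^{1/2}$, where $\mathcal L^d(B_1)$ is the volume of the unit ball in $\mathbb{R}^d$. $H^s(\mathbb{R}^d;\mathbb{R}^d)=\{u\in\mathscr S':(1+|\xi|^2)^{s/2}\hat u\in L^2\}$ with norm equivalent to $\|(1+|\xi|^2)^{s/2}\hat u\|_{L^2}$. *)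

(* Defs.v *)
From HB Require Import structures.
From mathcomp Require Import all_boot all_order all_algebra.
From mathcomp Require Import all_classical all_reals all_analysis.
Set Implicit Arguments. Unset Strict Implicit. Unset Printing Implicit Defensive.
Import Order.TTheory GRing.Theory Num.Theory.
Import numFieldNormedType.Exports.
Local Open Scope classical_set_scope.
Local Open Scope ring_scope.

Section Defs.
Variable R : realType.

Definition tcoord (d : nat) (x : d.-tuple R) (i : 'I_d) : R := tnth x i.

Definition dotRd (d : nat) (x y : d.-tuple R) : R :=
  \sum_(i < d) tnth x i * tnth y i.
Definition enorm (d : nat) (x : d.-tuple R) : R := Num.sqrt (dotRd x x).

Definition negRd (d : nat) (x : d.-tuple R) : d.-tuple R :=
  map_tuple (fun r => - r) x.

(** Lebesgue integral over R^d of a function with values in \bar R,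
    realised as the iterated one-dimensional Lebesgue integral
    (for the nonnegative measurable integrands used below this is the
    d-dimensional Lebesgue integral, by Tonelli). *)
Fixpoint intRd (n : nat) : (n.-tuple R -> \bar R) -> \bar R :=
  match n return (n.-tuple R -> \bar R) -> \bar R with
  | 0 => fun f => f [tuple]
  | n'.+1 => fun f =>
      (\int[@lebesgue_measure R]_x intRd (fun t : n'.-tuple R => f [tuple of x :: t]))%E
  end.

Definition unit_ball_vol (d : nat) : R :=
  fine (intRd (fun y : d.-tuple R => (if enorm y <= 1 then 1 else 0)%:E)).

Definition gamma_const (d : nat) (kappa alpha : R) (chi : R -> R) : R :=
  Num.sqrt (kappa / 2 * unit_ball_vol d *
    fine (\int[@lebesgue_measure R]_(rho in `[0%R, 1%R]) (chi rho * rho `^ (1 - 2 * alpha))%:E)%E).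

Definition omega (d : nat) (kappa alpha : R) (chi : R -> R) (delta : R)
    (xi : d.-tuple R) : R :=
  Num.sqrt (kappa / delta `^ (2 * (1 - alpha)) *
    fine (intRd (fun y : d.-tuple R =>
       (chi (enorm y / delta) * (1 - cos (dotRd y xi))
          / enorm y `^ (d%:R + 2 * alpha))%:E))).

Definition sinc_t (w t : R) : R := if w == 0 then t else sin (w * t) / w.

(** A vector field R^d -> C^d given by real and imaginary parts of each
    of its d components. *)
Definition cfield (d : nat) := 'I_d -> d.-tuple R -> R * R.

Definition msol (d : nat) (m : d.-tuple R -> R) (a b : cfield d) (t : R) : cfield d :=
  fun i xi => (cos (m xi * t) * (a i xi).1 + sinc_t (m xi) t * (b i xi).1,
               cos (m xi * t) * (a i xi).2 + sinc_t (m xi) t * (b i xi).2).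

Definition dt_field (d : nat) (F : R -> cfield d) (t : R) : cfield d :=
  fun i xi => (derive1 (fun s => (F s i xi).1) t, derive1 (fun s => (F s i xi).2) t).

Definition diff_field (d : nat) (F G : cfield d) : cfield d :=
  fun i xi => ((F i xi).1 - (G i xi).1, (F i xi).2 - (G i xi).2).

(** Square of the H^s norm, on the Fourier side. *)
Definition Hs_norm2 (d : nat) (s : R) (F : cfield d) : \bar R :=
  intRd (fun xi : d.-tuple R =>
    ((1 + enorm xi ^+ 2) `^ s * \sum_(i < d) ((F i xi).1 ^+ 2 + (F i xi).2 ^+ 2))%:E).

Definition Hs_norm (d : nat) (s : R) (F : cfield d) : \bar R := sqrte (Hs_norm2 s F).

(** F is (a representative of) the Fourier transform of an element of
    H^s(R^d; R^d): measurable, Hermitian-symmetric (real-valued original),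
    with finite weighted L^2 norm. *)
Definition in_Hs_hat (d : nat) (s : R) (F : cfield d) : Prop :=
  [/\ forall i, measurable_fun setT (fun xi : d.-tuple R => (F i xi).1),
      forall i, measurable_fun setT (fun xi : d.-tuple R => (F i xi).2),
      forall i xi, (F i (negRd xi)).1 = (F i xi).1 /\ (F i (negRd xi)).2 = - (F i xi).2
    & (Hs_norm2 s F < +oo)%E].

End Defs.

(* Main.v *)
Require Import Defs.
From HB Require Import structures.
From mathcomp Require Import all_boot all_order all_algebra.
From mathcomp Require Import all_classical all_reals all_analysis.
From mathcomp Require Import measurable_realfun ring lra.
Set Implicit Arguments. Unset Strict Implicit. Unset Printing Implicit Defensive.
Import Order.TTheory GRing.Theory Num.Theory.
Import numFieldNormedType.Exports.
Local Open Scope classical_set_scope.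
Local Open Scope ring_scope.

(** By Plancherel everything happens on the Fourier side, with the multipliers
    [omega_delta] and [m = gamma |xi|].  Since the kernel is radial, the quadratic form
    [int chi_delta(y) (y.xi)^2 / |y|^(d+2 alpha) dy] is isotropic: reflections kill the mixed
    terms and permuting coordinates makes the diagonal terms equal; polar coordinates then
    evaluate it.  Inserting [x^2/2 (1 - x^2/12) <= 1 - cos x <= x^2/2] yields
    [m^2 (1 - (delta |xi|)^2/12) <= omega_delta^2 <= m^2] (the left part for
    [delta |xi| <= 1]), while keeping only [|y| <= min(delta/2, 1/|xi|)] yields
    [omega_delta >= c |xi|^alpha] for [|xi| >= 1], uniformly in [delta <= 1].
    For [|xi| <= N] the multipliers are thus [O(delta)]-close uniformly in [t <= T]; for
    [|xi| > N] they are bounded, with [|sin(omega_delta t)/omega_delta| <= C |xi|^-alpha]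
    absorbing the weaker regularity of [v0].  The contribution of [|xi| > N] is a tail of a
    convergent integral, so one lets first [delta -> 0], then [N -> oo]. *)

(** The integral is an iterated one-dimensional one, so each symmetry of Lebesgue measure is derived
    coordinate by coordinate from Tonelli. Rotations are out of reach this way, which is why
    isotropy rests on sign flips and exchanges of coordinates, and why the polar formula is obtained
    without a sphere measure: its constant is universal and is read off from the unit ball. The
    constants then match by cancellation: isotropy contributes [1 / d], polar coordinates contribute
    [d] times the ball volume, and [1 - cos x ~ x^2 / 2] gives the factor [kappa / 2] of [gamma].
    Substituting [r = delta rho] in the radial integral produces [delta^(2 (1 - alpha))], which the
    normalisation of the kernel removes, so all bounds on [omega] are uniform in [delta]. The two
    norms of the conclusion have matching reasons: the lower bound [omega^2 >= c |xi|^(2 alpha)]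
    lets [v0] lie [alpha] derivatives below [u0], whereas the upper bound [omega <= gamma |xi|]
    costs one derivative in [H^(s-1)]. *)

Section intRd_theory.
Variable R : realType.
Local Notation leb1 := (@lebesgue_measure R).

(** * The iterated integral as the integral for a sigma-finite measure *)

Lemma eq_intRd n (f g : n.-tuple R -> \bar R) : f =1 g -> intRd f = intRd g.
Proof. by move=> /funext ->. Qed.

Lemma intRd_ge0 n (f : n.-tuple R -> \bar R) :
  (forall x, 0 <= f x)%E -> (0 <= intRd f)%E.
Proof.
elim: n f => [|n IHn] f f0 //=; apply: integral_ge0 => x _.
exact: IHn.
Qed.

(* No measurability is needed: on nonnegative functions the Lebesgue integral
   is the supremum over simple functions below. *)
Lemma le_ge0_integral d (T : measurableType d)
    (mu : {measure set T -> \bar R}) (f g : T -> \bar R) :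
  (forall x, 0 <= f x)%E -> (forall x, f x <= g x)%E ->
  (\int[mu]_x f x <= \int[mu]_x g x)%E.
Proof.
move=> f0 fg; have g0 x : (0 <= g x)%E by exact: le_trans (f0 x) (fg x).
rewrite !ge0_integralTE//; apply: le_ereal_sup => _ [h hf <-].
by exists h => // x; exact: le_trans (hf x) (fg x).
Qed.

Lemma le_intRd n (f g : n.-tuple R -> \bar R) :
  (forall x, 0 <= f x)%E -> (forall x, f x <= g x)%E -> (intRd f <= intRd g)%E.
Proof.
elim: n f g => [|n IHn] f g f0 fg //=; apply: le_ge0_integral => x.
  exact: intRd_ge0.
exact: IHn.
Qed.

(** Rectangles of two increasing exhaustions cover the product; monotonicity lets a single index
    serve both factors. *)
Lemma sigma_finite_product d d' (T : measurableType d) (T' : measurableType d')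
    (m1 : {sigma_finite_measure set T -> \bar R})
    (m2 : {sigma_finite_measure set T' -> \bar R}) :
  sigma_finite setT (m1 \x m2)%E.
Proof.
have /sigma_finiteP[F [FT ndF Foo]] := sigma_finiteT m1.
have /sigma_finiteP[G [GT ndG Goo]] := sigma_finiteT m2.
exists (fun n => F n `*` G n) => [|n]; last first.
  have [mF oF] := Foo n; have [mG oG] := Goo n; split; first exact: measurableX.
  by rewrite product_measure1E// lte_mul_pinfty// ge0_fin_numE.
apply/esym/seteqP; split=> // -[x y] _.
have [i _ Fx] : (\bigcup_i F i) x by rewrite -FT.
have [j _ Gy] : (\bigcup_i G i) y by rewrite -GT.
exists (maxn i j) => //; split => /=.
  by have /subsetPset := ndF _ _ (leq_maxl i j); exact.
by have /subsetPset := ndG _ _ (leq_maxr i j); exact.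
Qed.

Lemma sigma_finite_pushforward d d' (T : measurableType d) (T' : measurableType d')
    (P : {measure set T -> \bar R}) (f : T -> T') (g : T' -> T) :
  sigma_finite setT P -> measurable_fun setT f -> measurable_fun setT g -> cancel f g ->
  exists Q : {sigma_finite_measure set T' -> \bar R},
    forall A, Q A = pushforward P f A.
Proof.
move=> [F FT FP] mf mg fK.
unshelve epose (Q := pushforward P f : {measure set T' -> \bar R}) => //.
have Qsf : sigma_finite setT Q.
  exists (fun i => g @^-1` F i); first by rewrite -preimage_bigcup -FT preimage_setT.
  move=> i; have [mF Fo] := FP i; split.
    by rewrite -[X in measurable X]setTI; exact: mg.
  rewrite (_ : Q _ = P (F i))//; rewrite /Q/= /pushforward; congr (P _).
  by apply/seteqP; split => x; rewrite /preimage/= fK.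
pose S := Measure_isSigmaFinite.Build _ _ _ Q Qsf.
pose Q' : {sigma_finite_measure set T' -> \bar R} := HB.pack (Measure.sort Q) S.
by exists Q'.
Qed.

(** Turns the recursion into integration against one measure, which gives access to additivity,
    monotone convergence and Tonelli with a parameter. The measure is a Dirac mass in dimension 0,
    then the image of a product under [cons]; sigma-finiteness is carried along because Tonelli asks
    for it at the next step. *)
Lemma intRd_measure n : exists mu : {sigma_finite_measure set (n.-tuple R) -> \bar R},
  forall f : n.-tuple R -> \bar R, measurable_fun setT f -> (forall x, 0 <= f x)%E ->
    intRd f = (\int[mu]_x f x)%E.
Proof.
elim: n => [|n [mu muE]].
  exists (dirac [tuple] : {sigma_finite_measure set _ -> \bar R}) => f mf f0.
  by rewrite /= integral_dirac// diracT mul1e.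
pose f (p : (measurableTypeR R * n.-tuple R)%type) : n.+1.-tuple R := [tuple of p.1 :: p.2].
pose g (t : n.+1.-tuple R) : (measurableTypeR R * n.-tuple R)%type :=
  (thead t, [tuple of behead t]).
have mf : measurable_fun setT f by exact: measurable_cons.
have mg : measurable_fun setT g.
  by apply/measurable_fun_pairP; split; [exact: measurable_tnth|exact: measurable_behead].
have fK : cancel f g.
  by move=> [x t]; rewrite /f /g theadE; congr pair; exact/val_inj.
have [Q QE] := sigma_finite_pushforward (sigma_finite_product leb1 mu) mf mg fK.
exists Q => h mh h0.
transitivity (\int[pushforward (leb1 \x mu)%E f]_x h x)%E; last first.
  apply: eq_measure_integral => A mA _; exact: esym (QE A).
rewrite ge0_integral_pushforward// preimage_setT.
have mhf : measurable_fun setT (h \o f) by exact: (measurableT_comp mh mf).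
rewrite (fubini_tonelli1 _ mhf); last by move=> p; exact: h0.
apply: eq_integral => x _; apply: muE => [|t]; last exact: h0.
exact: (measurableT_comp mhf (measurable_pair1 x)).
Qed.

Definition leb n : {sigma_finite_measure set (n.-tuple R) -> \bar R} :=
  sval (cid (intRd_measure n)).

Lemma intRdE n (f : n.-tuple R -> \bar R) :
  measurable_fun setT f -> (forall x, 0 <= f x)%E -> intRd f = (\int[leb n]_x f x)%E.
Proof. exact: (svalP (cid (intRd_measure n))). Qed.

Lemma measurable_fun_intRd d (T : measurableType d) n (f : T -> n.-tuple R -> \bar R) :
  measurable_fun setT (fun p : T * n.-tuple R => f p.1 p.2) ->
  (forall x t, 0 <= f x t)%E -> measurable_fun setT (fun x => intRd (f x)).
Proof.
move=> mf f0.
rewrite (_ : (fun x => _) = fubini_F (leb n) (fun p => f p.1 p.2)).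
  by apply: measurable_fun_fubini_tonelli_F.
apply/funext => x; rewrite intRdE//.
exact: (measurableT_comp mf (measurable_pair1 x)).
Qed.

Lemma intRdE_EFin n (f : n.-tuple R -> R) :
  measurable_fun setT f -> (forall x, 0 <= f x) ->
  intRd (fun x => (f x)%:E) = (\int[leb n]_x (f x)%:E)%E.
Proof.
by move=> mf f0; apply: intRdE; [exact/measurable_EFinP|move=> x; rewrite lee_fin].
Qed.

Lemma intRdD n (f g : n.-tuple R -> R) :
  measurable_fun setT f -> measurable_fun setT g ->
  (forall x, 0 <= f x) -> (forall x, 0 <= g x) ->
  (intRd (fun x => (f x + g x)%:E) =
   intRd (fun x => (f x)%:E) + intRd (fun x => (g x)%:E))%E.
Proof.
move=> mf mg f0 g0.
rewrite (intRdE_EFin mf)// (intRdE_EFin mg)// intRdE_EFin; last 2 first.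
- exact: measurable_funD.
- by move=> x; exact: addr_ge0.
under eq_integral do rewrite EFinD.
by apply: ge0_integralD => //; do ?[by move=> x _; rewrite lee_fin]; exact/measurable_EFinP.
Qed.

Lemma intRdZ n (k : R) (f : n.-tuple R -> R) :
  0 <= k -> measurable_fun setT f -> (forall x, 0 <= f x) ->
  (intRd (fun x => (k * f x)%:E) = k%:E * intRd (fun x => (f x)%:E))%E.
Proof.
move=> k0 mf f0; rewrite (intRdE_EFin mf)// intRdE_EFin; last 2 first.
- exact: measurable_funM.
- by move=> x; exact: mulr_ge0.
under eq_integral do rewrite EFinM.
by apply: ge0_integralZl => //; do ?[by move=> x _; rewrite lee_fin]; exact/measurable_EFinP.
Qed.

Lemma intRd0 n : intRd (fun _ : n.-tuple R => 0%E) = 0%E.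
Proof. by elim: n => //= n ->; rewrite integral0. Qed.

Lemma intRd_sum n (I : Type) (s : seq I) (f : I -> n.-tuple R -> R) :
  (forall i, measurable_fun setT (f i)) -> (forall i x, 0 <= f i x) ->
  (intRd (fun x => (\sum_(i <- s) f i x)%:E) = \sum_(i <- s) intRd (fun x => (f i x)%:E))%E.
Proof.
move=> mf f0; elim: s => [|i s IHs].
  by rewrite big_nil -(intRd0 n); apply: eq_intRd => x; rewrite big_nil.
rewrite big_cons -IHs -intRdD//.
- by apply: eq_intRd => x; rewrite big_cons.
- exact: measurable_sum.
- by move=> x; exact: sumr_ge0.
Qed.

End intRd_theory.

(** * Reordering, reflecting and scaling coordinates *)

Section change_of_variables.
Variable R : realType.
Local Notation leb1 := (@lebesgue_measure R).

Lemma integral_oppR (f : R -> \bar R) : measurable_fun setT f ->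
  (forall x, 0 <= f x)%E -> (\int[leb1]_x f (- x)%R = \int[leb1]_x f x)%E.
Proof.
move=> mf f0.
have mN : measurable_fun [set: measurableTypeR R] (-%R : measurableTypeR R -> measurableTypeR R).
  exact: measurable_funN.
transitivity (\int[pushforward leb1 (-%R : measurableTypeR R -> measurableTypeR R)]_x f x)%E.
  by rewrite ge0_integral_pushforward// preimage_setT.
apply: eq_measure_integral => A mA _; exact: lebesgue_measureN.
Qed.

Lemma integral_scaleR (c : R) (f : R -> \bar R) : 0 < c -> measurable_fun setT f ->
  (forall x, 0 <= f x)%E -> (\int[leb1]_x f x = c%:E * \int[leb1]_x f (c * x)%R)%E.
Proof.
move=> c0 mf f0.
have mM : measurable_fun [set: measurableTypeR R] ( *%R c : measurableTypeR R -> measurableTypeR R).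
  exact: measurable_funM.
have c0' := ltW c0.
unshelve epose (m := mscale (NngNum c0') (pushforward leb1
  ( *%R c : measurableTypeR R -> measurableTypeR R)) : {measure set (measurableTypeR R) -> \bar R}) => //.
transitivity (\int[m]_x f x)%E.
  (* Lebesgue measure is determined by half-open intervals. The preimage of []a, b]] under
     multiplication by [c] has length [(b - a) / c], which the factor [c] in [m] compensates. *)
  apply: eq_measure_integral => A mA _; apply: lebesgue_measure_unique => // _ [[a b]] _ <-.
  rewrite /m/= /mscale/= /pushforward.
  rewrite (_ : _ @^-1` _ = `]a / c, b / c]%classic).
    rewrite !lebesgue_measure_itv/= !lte_fin ltr_pM2r ?invr_gt0//.
    case: ifPn => ab; last by rewrite mule0.
    by rewrite -EFinD -EFinM -mulrBl mulrCA divff ?mulr1// gt_eqF.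
  by apply/seteqP; split => x; rewrite /= !in_itv/= ltr_pdivrMr// ler_pdivlMr// mulrC.
rewrite /m ge0_integral_mscale// ge0_integral_pushforward// preimage_setT//.
Qed.

(** Singles out an arbitrary coordinate, whereas the recursion of [intRd] peels off only the first
    one. *)
Definition ins n (i : 'I_n.+1) (x : R) (t : n.-tuple R) : n.+1.-tuple R :=
  [tuple if unlift i k is Some j then tnth t j else x | k < n.+1].

Lemma tnth_ins n (i : 'I_n.+1) x t : tnth (ins i x t) i = x.
Proof. by rewrite tnth_mktuple unlift_none. Qed.

Lemma tnth_ins_lift n (i : 'I_n.+1) x t j : tnth (ins i x t) (lift i j) = tnth t j.
Proof. by rewrite tnth_mktuple liftK. Qed.

Lemma ins0 n x (t : n.-tuple R) : ins ord0 x t = [tuple of x :: t].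
Proof.
apply: eq_from_tnth => k; case: (unliftP ord0 k) => [j|] ->.
  by rewrite tnth_ins_lift tnthS.
by rewrite tnth_ins.
Qed.

Lemma insS n (i : 'I_n.+1) x y (t : n.-tuple R) :
  ins (lift ord0 i) x [tuple of y :: t] = [tuple of y :: ins i x t].
Proof.
apply: eq_from_tnth => k; case: (unliftP (lift ord0 i) k) => [j|] ->.
  rewrite tnth_ins_lift; case: (unliftP ord0 j) => [l|] ->.
    rewrite tnthS (_ : lift _ (lift _ _) = lift ord0 (lift i l)).
      by rewrite tnthS tnth_ins_lift.
    by apply/val_inj; rewrite /= /bump/= !add1n ltnS addnS.
  rewrite (_ : lift _ _ = ord0)//.
  by apply/val_inj.
by rewrite tnth_ins tnthS tnth_ins.
Qed.

Lemma measurable_ins n (i : 'I_n.+1) :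
  measurable_fun setT (fun p : R * n.-tuple R => ins i p.1 p.2).
Proof.
apply/measurable_fun_tnthP => k; case: (unliftP i k) => [j|] ->.
  rewrite (_ : _ \o _ = (fun t : n.-tuple R => tnth t j) \o snd).
    by apply: measurableT_comp => //; exact: measurable_tnth.
  by apply/funext => p /=; rewrite tnth_ins_lift.
rewrite (_ : _ \o _ = fst)//.
by apply/funext => p /=; rewrite tnth_ins.
Qed.

(** Any coordinate can be the outermost variable: the induction hypothesis brings it to second
    place, and Tonelli in the plane exchanges it with the first. *)
Lemma intRd_ins n (i : 'I_n.+1) (f : n.+1.-tuple R -> \bar R) :
  measurable_fun setT f -> (forall x, 0 <= f x)%E ->
  intRd f = (\int[leb1]_x intRd (fun t => f (ins i x t)))%E.
Proof.
elim: n i f => [|n IHn] i f mf f0.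
  by rewrite /= ord1; apply: eq_integral => x _; rewrite ins0.
case: (unliftP ord0 i) => [j|] ->; last first.
  apply: eq_integral => x _; transitivity (intRd (fun t : n.+1.-tuple R => f [tuple of x :: t])) => //.
  by apply: eq_intRd => t; rewrite ins0.
(* All coordinates are integrated out except the head [p.1] and the selected one [p.2]. *)
pose h (p : R * R) := intRd (fun t : n.-tuple R => f [tuple of p.1 :: ins j p.2 t]).
have mh : measurable_fun setT h.
  apply: measurable_fun_intRd => [|? ?]; last exact: f0.
  apply: (measurableT_comp mf); apply: measurable_cons => /=.
    exact: measurableT_comp.
  pose q (p : R * R * n.-tuple R) := (p.1.2, p.2).
  apply: (measurableT_comp (@measurable_ins n j) (_ : measurable_fun setT q)).
  apply/measurable_fun_pairP; split; last exact: measurable_snd.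
  exact: (measurableT_comp measurable_snd measurable_fst).
have h0 p : (0 <= h p)%E by exact: intRd_ge0.
have := @fubini_tonelli _ _ _ _ _ leb1 leb1 h mh h0.
rewrite /fubini_F /fubini_G => hE.
transitivity (\int[leb1]_y \int[leb1]_x h (y, x))%E.
  rewrite [LHS](_ : _ = \int[leb1]_y intRd (fun t : n.+1.-tuple R => f [tuple of y :: t]))%E;
    last by [].
  apply: eq_integral => y _; apply: (IHn j (fun t => f [tuple of y :: t])) => //.
  by apply: (measurableT_comp mf); exact: measurable_cons.
rewrite hE; apply: eq_integral => x _ /=; apply: eq_integral => y _.
by apply: eq_intRd => t; rewrite insS.
Qed.

Lemma sum_ins n (i : 'I_n.+1) x t (F : 'I_n.+1 -> R -> R) :
  \sum_k F k (tnth (ins i x t) k) = F i x + \sum_j F (lift i j) (tnth t j).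
Proof.
rewrite (bigD1_ord i)//= tnth_ins; congr (_ + _); apply: eq_bigr => j _.
by rewrite tnth_ins_lift.
Qed.

Lemma dotRd_ins n (i : 'I_n.+1) x (t : n.-tuple R) :
  dotRd (ins i x t) (ins i x t) = x * x + dotRd t t.
Proof. by rewrite /dotRd (sum_ins i x t (fun _ y => y * y)). Qed.

(** The right side does not depend on [i]; this is how radial functions see all coordinates
    alike. *)
Lemma enorm_ins n (i : 'I_n.+1) x (t : n.-tuple R) :
  enorm (ins i x t) = Num.sqrt (x * x + dotRd t t).
Proof. by rewrite /enorm dotRd_ins. Qed.

Definition refl n (i : 'I_n) (t : n.-tuple R) : n.-tuple R :=
  [tuple (if k == i then - tnth t k else tnth t k) | k < n].

Lemma refl_ins n (i : 'I_n.+1) x t : refl i (ins i x t) = ins i (- x) t.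
Proof.
apply: eq_from_tnth => k; rewrite tnth_mktuple; case: (unliftP i k) => [j|] ->.
  by rewrite !tnth_ins_lift eq_sym (negbTE (neq_lift _ _)).
by rewrite eqxx !tnth_ins.
Qed.

Lemma enorm_refl n (i : 'I_n) t : enorm (refl i t) = enorm t.
Proof.
congr Num.sqrt; apply: eq_bigr => k _; rewrite tnth_mktuple.
by case: ifP => // _; rewrite mulrNN.
Qed.

Lemma intRd_refl n (i : 'I_n) (f : n.-tuple R -> \bar R) :
  measurable_fun setT f -> (forall x, 0 <= f x)%E ->
  intRd (fun t => f (refl i t)) = intRd f.
Proof.
case: n i f => [[]//|n] i f mf f0.
have mr : measurable_fun setT (@refl n.+1 i).
  apply/measurable_fun_tnthP => k.
  rewrite (_ : _ \o _ = fun t => if k == i then - tnth t k else tnth t k).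
    by case: (k == i); [apply: measurable_funN|]; exact: measurable_tnth.
  by apply/funext => t /=; rewrite tnth_mktuple.
rewrite !(intRd_ins i)//; last exact: (measurableT_comp mf mr).
pose g x := intRd (fun t => f (ins i x t)).
rewrite -[RHS](@integral_oppR g); last 2 first.
- apply: measurable_fun_intRd => [|x t]; last exact: f0.
  exact: (measurableT_comp mf (@measurable_ins n i)).
- by move=> x; apply: intRd_ge0.
apply: eq_integral => x _; apply: eq_intRd => t.
by rewrite refl_ins.
Qed.

Definition scaleT n (r : R) (t : n.-tuple R) : n.-tuple R := map_tuple ( *%R r) t.

Lemma measurable_scaleT n r : measurable_fun setT (@scaleT n r).
Proof.
apply/measurable_fun_tnthP => k.
rewrite (_ : _ \o _ = fun t => r * tnth t k).
  by apply: measurable_funM => //; exact: measurable_tnth.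
by apply/funext => t /=; rewrite tnth_map.
Qed.

Lemma enorm_scaleT n r (t : n.-tuple R) : 0 <= r -> enorm (scaleT r t) = r * enorm t.
Proof.
move=> r0; rewrite /enorm (_ : dotRd _ _ = r ^+ 2 * dotRd t t).
  by rewrite sqrtrM ?sqr_ge0// sqrtr_sqr ger0_norm.
rewrite /dotRd mulr_sumr; apply: eq_bigr => k _.
by rewrite tnth_map mulrACA expr2.
Qed.

(** Each coordinate contributes one factor [r], by the one-dimensional substitution. *)
Lemma intRd_scale n r (f : n.-tuple R -> \bar R) : 0 < r ->
  measurable_fun setT f -> (forall x, 0 <= f x)%E ->
  (intRd f = (r ^+ n)%:E * intRd (fun t => f (scaleT r t)))%E.
Proof.
move=> r0; elim: n f => [|n IHn] f mf f0 /=.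
  by rewrite expr0 mul1e; congr f; exact/val_inj.
pose g (x : R) := intRd (fun t : n.-tuple R => f [tuple of x :: t]).
have mg : measurable_fun setT g.
  apply: measurable_fun_intRd => [|x t]; last exact: f0.
  by apply: (measurableT_comp mf); exact: measurable_cons.
have g0 x : (0 <= g x)%E by exact: intRd_ge0.
rewrite -/(\int[leb1]_x g x)%E (integral_scaleR r0 mg g0) exprS EFinM -muleA.
congr (_ * _)%E.
pose h (x : R) := intRd (fun t : n.-tuple R => f (scaleT r [tuple of x :: t])).
have mh : measurable_fun setT h.
  apply: measurable_fun_intRd => [|x t]; last exact: f0.
  apply: (measurableT_comp mf); apply: (measurableT_comp (@measurable_scaleT n.+1 r)).
  exact: measurable_cons.
have rn0 : (0 <= (r ^+ n)%:E)%E by rewrite lee_fin exprn_ge0// ltW.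
have h0 x : (0 <= h x)%E by exact: intRd_ge0.
rewrite -[RHS](@ge0_integralZl _ _ _ leb1 setT _ h mh (r ^+ n)%:E)//.
apply: eq_integral => x _; rewrite /g IHn//; last first.
  by apply: (measurableT_comp mf); exact: measurable_cons.
congr (_ * _)%E; apply: eq_intRd => t; congr f; exact/val_inj.
Qed.

End change_of_variables.

(** * Integrals of powers near the origin *)

Section one_dimensional.
Variable R : realType.
Local Notation leb1 := (@lebesgue_measure R).

Lemma measurable_boolr d (T : measurableType d) (b : T -> bool) :
  measurable_fun setT b -> measurable_fun setT (fun x => (b x)%:R : R).
Proof.
move=> mb; rewrite (_ : (fun x => _) = fun x => if b x then 1 else 0).
  exact: measurable_fun_ifT.
by apply/funext => x; case: (b x).
Qed.

Lemma FTC_powR (p a : R) : p != 0 -> 0 < a < 1 ->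
  (\int[leb1]_(x in `[a, 1%R]) (x `^ (p - 1))%:E = ((1 - a `^ p) / p)%:E)%E.
Proof.
move=> p0 /andP[a0 a1].
pose F (x : R) := x `^ p / p.
have dF (x : R) : 0 < x -> is_derive x 1 F (x `^ (p - 1)).
  move=> x0.
  have := is_deriveZ p^-1 (is_derive1_powR p x0).
  rewrite /GRing.scale/= mulrA mulVf// mul1r (_ : _ \*: _ = F)//.
  by apply/funext => y; rewrite /F mulrC.
have cF x : 0 < x -> {for x, continuous F}.
  move=> x0; apply: differentiable_continuous; apply/derivable1_diffP.
  by have := dF _ x0.
rewrite (@continuous_FTC2 _ _ F)//.
- by rewrite /F powR1 -EFinB -mulrBl.
- apply: continuous_in_subspaceT => x; rewrite inE/= in_itv/= => /andP[ax _].
  have x0 := lt_le_trans a0 ax.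
  apply: differentiable_continuous; apply/derivable1_diffP.
  by apply: derivable_powR; rewrite in_itv/= andbT.
- split.
  + by move=> x; rewrite in_itv/= => /andP[ax _]; have := dF _ (lt_trans a0 ax).
  + by apply: cvg_at_right_filter; exact: cF.
  + by apply: cvg_at_left_filter; apply: cF; exact: ltr01.
- move=> x; rewrite in_itv/= => /andP[ax _].
  have := dF _ (lt_trans a0 ax); rewrite derive1E => d; exact: derive_val.
Qed.

(** The interval is encoded by indicator factors, so that scaling can act on an integral over the
    whole line. *)
Lemma integral_powR01 (p : R) : 0 < p ->
  (\int[leb1]_x ((0 < x)%R%:R * (x <= 1)%R%:R * x `^ (p - 1))%:E = (p^-1)%:E)%E.
Proof.
move=> p0.
(* For [p < 1] the integrand is singular at [0], so the fundamental theorem is applied on intervals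
   increasing to []0, 1]]. Starting at [1 / (m + 2)] keeps the left endpoint strictly below [1], as
   [FTC_powR] requires. *)
pose F (m : nat) : set R := `[m.+2%:R^-1, 1%R]%classic.
pose f (x : R) := (x `^ (p - 1))%:E.
have mf D : measurable_fun D f.
  by apply/measurable_EFinP; apply: measurable_funTS; exact: measurable_powR.
have UF : \bigcup_m F m = `]0%R, 1%R]%classic.
  apply/seteqP; split => x /=; rewrite /F/= in_itv/=.
    move=> [m _]; rewrite /= in_itv/= => /andP[mx ->]; rewrite andbT.
    by apply: lt_le_trans mx; rewrite invr_gt0.
  move=> /andP[x0 x1]; exists (Num.truncn x^-1) => //=.
  rewrite in_itv/= x1 andbT -[leRHS]invrK lef_pV2 ?posrE ?invr_gt0//.
  by apply/ltW/(lt_trans (truncnS_gt _)); rewrite ltr_nat.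
transitivity (\int[leb1]_(x in `]0%R, 1%R]) f x)%E.
  rewrite [RHS]integral_mkcond; apply: eq_integral => x _; rewrite patchE.
  rewrite mem_setE in_itv/=.
  by case: (0 < x); case: (x <= 1); rewrite /= ?(mul1r, mulr0, mul0r).
have ndF : nondecreasing_seq F.
  move=> m n mn; apply/subsetPset => x; rewrite /F/= !in_itv/= => /andP[mx ->].
  by rewrite andbT (le_trans _ mx)// lef_pV2 ?posrE// ler_nat !ltnS.
have f0 i x : F i x -> (0 <= f x)%E by rewrite /f lee_fin powR_ge0.
have := @ge0_nondecreasing_set_cvg_integral _ (measurableTypeR R) R F f leb1
  ndF (fun n => measurable_itv _) (fun n => mf (F n)) f0.
rewrite UF => cvgF; apply: (cvg_unique _ cvgF) => //.
rewrite (_ : (fun i => _) = fun m => ((1 - (m.+2%:R^-1 : R) `^ p) / p)%:E); last first.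
  apply/funext => m; rewrite -FTC_powR//; first by rewrite gt_eqF.
  by rewrite invr_gt0 ltr0n/= invf_lt1// ltr1n.
apply: cvg_EFin; first exact: nearW.
rewrite -[X in _ --> X]mul1r; apply: cvgMl.
rewrite -[X in _ --> X]subr0; apply: cvgB; first exact: cvg_cst.
apply: (@cvg_comp _ _ _ _ (fun a : R => a `^ p) _ (0^'+)); last exact: powR_cvg0.
move=> A [e/= e0 eA].
have := near_infty_natSinv_lt (PosNum e0); apply: filterS => m /= me.
apply: eA; last by rewrite /= invr_gt0.
rewrite /ball_/= sub0r normrN ger0_norm ?invr_ge0//; apply: le_lt_trans me.
by rewrite lef_pV2 ?posrE// ler_nat.
Qed.

Lemma integral_powR_itv (p r : R) : 0 < p -> 0 < r ->
  (\int[leb1]_x ((0 < x)%R%:R * (x <= r)%R%:R * x `^ (p - 1))%:E = (r `^ p / p)%:E)%E.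
Proof.
move=> p0 r0; rewrite (integral_scaleR r0); last 2 first.
- apply/measurable_EFinP; apply: measurable_funM; last exact: measurable_powR.
  by apply: measurable_funM; apply: measurable_boolr;
    [exact: measurable_fun_ltr|exact: measurable_fun_ler].
- by move=> x; rewrite lee_fin !mulr_ge0// powR_ge0.
under eq_integral => x _.
  rewrite pmulr_rgt0// [r * x <= r]ger_pMr//.
  rewrite (_ : (0 < x)%R%:R * (x <= 1)%R%:R * (r * x) `^ (p - 1) = r `^ (p - 1) * ((0 < x)%R%:R * (x <= 1)%R%:R * x `^ (p - 1))); last first.
    case: ltP => [x0|_]; last by rewrite !mul0r mulr0.
    by rewrite (powRM _ (ltW r0) (ltW x0)) mulrCA.
  rewrite EFinM; over.
rewrite ge0_integralZl//=; last 3 first.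
- apply/measurable_EFinP; apply: measurable_funM; last exact: measurable_powR.
  by apply: measurable_funM; apply: measurable_boolr;
    [exact: measurable_fun_ltr|exact: measurable_fun_ler].
- by move=> x _; rewrite lee_fin !mulr_ge0// powR_ge0.
- by rewrite lee_fin powR_ge0.
rewrite integral_powR01// -!EFinM mulrA; congr (_ / _)%:E.
by rewrite -[X in X * _]powRr1 ?ltW// -powRD ?gt_eqF ?implybT// addrC subrK.
Qed.

End one_dimensional.

(** * Volume of the unit ball, bounded by cubes from both sides *)

Section unit_ball.
Variable R : realType.
Local Notation leb1 := (@lebesgue_measure R).

Lemma measurable_dotRd n (xi : n.-tuple R) : measurable_fun setT (fun z : n.-tuple R => dotRd z xi).
Proof.
by apply: measurable_sum => i; apply: measurable_funM => //; exact: measurable_tnth.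
Qed.

Lemma measurable_dotRdd n : measurable_fun setT (fun z : n.-tuple R => dotRd z z).
Proof.
by apply: measurable_sum => i; apply: measurable_funM => //; exact: measurable_tnth.
Qed.

Lemma measurable_enorm n : measurable_fun setT (@enorm R n).
Proof.
apply: measurableT_comp; last exact: measurable_dotRdd.
by apply: continuous_measurable_fun; exact: sqrt_continuous.
Qed.

Lemma enorm_ge0 n (z : n.-tuple R) : 0 <= enorm z. Proof. exact: sqrtr_ge0. Qed.

Lemma dotRdd_ge0 n (z : n.-tuple R) : 0 <= dotRd z z.
Proof. by apply: sumr_ge0 => i _; rewrite -expr2 sqr_ge0. Qed.

Lemma sqr_enorm n (z : n.-tuple R) : enorm z ^+ 2 = dotRd z z.
Proof. by rewrite sqr_sqrtr// dotRdd_ge0. Qed.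

Lemma intRd_prod n (phi : R -> R) (c : R) : measurable_fun setT phi ->
  (forall x, 0 <= phi x) -> (\int[leb1]_x (phi x)%:E = c%:E)%E ->
  intRd (fun z : n.-tuple R => (\prod_(x <- z) phi x)%:E) = (c ^+ n)%:E.
Proof.
move=> mphi phi0 phic.
have c0 : 0 <= c by rewrite -lee_fin -phic; apply: integral_ge0 => x _; rewrite lee_fin.
have mprod m : measurable_fun setT (fun z : m.-tuple R => \prod_(x <- z) phi x).
  under eq_fun do rewrite big_tuple.
  apply: measurable_prod => i _; apply: measurableT_comp => //; exact: measurable_tnth.
elim: n => [|n IHn]; first by rewrite /= big_nil expr0.
transitivity (\int[leb1]_x ((c ^+ n)%:E * (phi x)%:E))%E; last first.
  rewrite ge0_integralZl//= ?phic -?EFinM -?exprSr//.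
  - exact/measurable_EFinP.
  - by move=> x _; rewrite lee_fin.
  - by rewrite lee_fin exprn_ge0.
apply: eq_integral => x _.
rewrite -IHn muleC -(intRdZ _ (mprod n))// => [|z]; last exact: prodr_ge0.
by apply: eq_intRd => z; rewrite big_cons.
Qed.

Definition unit_ball_ind n (z : n.-tuple R) : R := if enorm z <= 1 then 1 else 0.

Lemma integral_ind_itv (a b : R) : a <= b ->
  (\int[leb1]_x (\1_(`[a, b]%classic) x)%:E = (b - a)%:E)%E.
Proof.
move=> ab; rewrite integral_indic//= setIT lebesgue_measure_itv/= lte_fin.
rewrite lt_neqAle ab andbT; case: eqP => [->|//=]; by rewrite subrr.
Qed.

Lemma intRd_box n (a b : R) : a <= b ->
  intRd (fun z : n.-tuple R => (\prod_(x <- z) \1_(`[a, b]%classic) x)%:E) =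
  ((b - a) ^+ n)%:E.
Proof.
by move=> ab; apply: intRd_prod => //; exact: integral_ind_itv.
Qed.

Lemma tnth_le_enorm n (z : n.-tuple R) i : `|tnth z i| <= enorm z.
Proof.
rewrite -sqrtr_sqr ler_wsqrtr// /dotRd (bigD1 i)//= -expr2 lerDl.
by apply: sumr_ge0 => j _; rewrite -expr2 sqr_ge0.
Qed.

(** The cube [[-1, 1]^n] contains the ball, so the volume is finite and [fine] does not collapse it
    to [0]. *)
Lemma unit_ball_volE n :
  intRd (fun z : n.-tuple R => (unit_ball_ind z)%:E) = (unit_ball_vol R n)%:E.
Proof.
rewrite /unit_ball_vol fineK// ge0_fin_numE; last first.
  by apply: intRd_ge0 => z; rewrite lee_fin; case: ifP.
pose phi : R -> R := \1_(`[(-1), 1]%classic).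
apply: (@le_lt_trans _ _ (intRd (fun z : n.-tuple R => (\prod_(x <- z) phi x)%:E))).
  apply: le_intRd => z; rewrite lee_fin; case: ifP => // z1.
    rewrite big_tuple big1// => i _; rewrite /phi indicE mem_set//= in_itv/=.
    by rewrite -ler_norml (le_trans (tnth_le_enorm _ _)).
  by apply: prodr_ge0 => x _; rewrite /phi indicE.
by rewrite intRd_box ?lerN10// ltry.
Qed.

Lemma unit_ball_vol_gt0 n : 0 < unit_ball_vol R n.
Proof.
rewrite -lte_fin -unit_ball_volE.
(* The cube [[0, a]^n] lies in the ball: each square is at most [a * a <= a], and [n * a <= 1]. The
   successor keeps [a] meaningful for [n = 0]. *)
pose a : R := n.+1%:R^-1.
have a0 : 0 < a by rewrite invr_gt0.
pose phi : R -> R := \1_(`[0, a]%classic).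
apply: (@lt_le_trans _ _ (intRd (fun z : n.-tuple R => (\prod_(x <- z) phi x)%:E))).
  by rewrite intRd_box ?(ltW a0)// lte_fin subr0 exprn_gt0.
apply: le_intRd => z; rewrite lee_fin.
  by apply: prodr_ge0 => x _; rewrite /phi indicE.
rewrite /unit_ball_ind big_tuple.
have [/existsP[i zi]|/existsPn za] := boolP [exists i, phi (tnth z i) == 0].
  by rewrite (bigD1 i)//= (eqP zi) mul0r; case: ifP.
have {}za i : 0 <= tnth z i <= a.
  by have := za i; rewrite /phi indicE mem_setE in_itv/=; case: (_ <= _ <= _) => //=; rewrite eqxx.
rewrite ifT.
  by apply: prodr_ile1 => i _; rewrite /phi indicE; case: (_ \in _); rewrite ?lexx ?ler01.
rewrite -[leRHS]sqrtr1 ler_wsqrtr//.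
apply: (@le_trans _ _ (\sum_(i < n) a)).
  apply: ler_sum => i _; have /andP[z0 zia] := za i.
  apply: (le_trans (ler_pM _ _ zia zia)) => //.
  by rewrite ger_pMr// invf_le1// ler1n.
rewrite sumr_const card_ord -mulr_natl ler_pdivrMr// mul1r ler_nat//.
Qed.

(* The origin is Lebesgue-null as soon as there is at least one coordinate. *)
Lemma punctured_ball_vol n : (0 < n)%N ->
  intRd (fun z : n.-tuple R => ((0 < enorm z)%R%:R * (enorm z <= 1)%R%:R)%:E) =
  (unit_ball_vol R n)%:E.
Proof.
move=> n0.
have mind : measurable_fun setT (fun z : n.-tuple R => (0 < enorm z)%R%:R * (enorm z <= 1)%R%:R : R).
  by apply: measurable_funM; apply: measurable_boolr;
    [apply: measurable_fun_ltr|apply: measurable_fun_ler] => //; exact: measurable_enorm.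
have ind0 (z : n.-tuple R) : 0 <= (0 < enorm z)%R%:R * (enorm z <= 1)%R%:R :> R.
  by rewrite mulr_ge0.
apply/eqP; rewrite eq_le -unit_ball_volE; apply/andP; split.
  apply: le_intRd => z; rewrite lee_fin// /unit_ball_ind.
  by case: (0 < _); case: (_ <= 1); rewrite ?mul1r ?mul0r ?ler01.
(* The product of the [phi] is the indicator of the origin; its integral is [0 ^+ n], which vanishes
   because [n] is positive. *)
pose phi : R -> R := \1_(`[0, 0]%classic).
have phi0 x : 0 <= phi x by rewrite /phi indicE.
have mphi : measurable_fun setT phi by exact: measurable_indic.
have mprod : measurable_fun setT (fun z : n.-tuple R => \prod_(x <- z) phi x).
  under eq_fun do rewrite big_tuple.
  apply: measurable_prod => i _; apply: measurableT_comp => //; exact: measurable_tnth.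
rewrite -[leRHS]adde0.
have <- : intRd (fun z : n.-tuple R => (\prod_(x <- z) phi x)%:E) = 0%E.
  by rewrite intRd_box// subrr expr0n gtn_eqF.
rewrite -intRdD// => [|z]; last exact: prodr_ge0.
apply: le_intRd => z; rewrite lee_fin /unit_ball_ind; first by case: ifP.
case: ifP => z1; last by rewrite addr_ge0// prodr_ge0.
rewrite mulr1; have := enorm_ge0 z; rewrite le_eqVlt => /predU1P[z0|->]; last first.
  by rewrite lerDl prodr_ge0.
rewrite big_tuple big1 ?lerDr// => i _.
rewrite /phi indicE mem_set//= in_itv/=.
have := tnth_le_enorm z i; rewrite -z0 normr_le0 => /eqP ->.
by rewrite lexx.
Qed.

End unit_ball.

(** * Second moments of radial functions *)

Section isotropy.
Variable R : realType.
Local Notation leb1 := (@lebesgue_measure R).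

Section second_moments.
Variables (n : nat) (g : R -> R).
Hypotheses (mg : measurable_fun setT g) (g0 : forall x, 0 <= g x).

Let mgz : measurable_fun setT (fun z : n.-tuple R => g (enorm z)).
Proof. by apply: measurableT_comp => //; exact: measurable_enorm. Qed.

(* Reflecting one coordinate at a time kills the mixed products. *)
Lemma intRd_radial_sum_sqr (s : seq 'I_n) (a : 'I_n -> R) : uniq s ->
  (intRd (fun z : n.-tuple R => (g (enorm z) * (\sum_(i <- s) tnth z i * a i) ^+ 2)%:E) =
   \sum_(i <- s) intRd (fun z : n.-tuple R => (g (enorm z) * (tnth z i * a i) ^+ 2)%:E))%E.
Proof.
have mlin i : measurable_fun setT (fun z : n.-tuple R => tnth z i * a i).
  by apply: measurable_funM => //; exact: measurable_tnth.
elim: s => [|i s IHs] /=.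
  rewrite big_nil => _; under eq_intRd do rewrite big_nil expr0n mulr0.
  exact: intRd0.
move=> /andP[is_ us]; rewrite big_cons -IHs//.
pose A (z : n.-tuple R) := \sum_(j <- s) tnth z j * a j.
pose B (z : n.-tuple R) := tnth z i * a i.
have mA : measurable_fun setT A by exact: measurable_sum.
have mB : measurable_fun setT B by exact: mlin.
(* Reflecting coordinate [i] exchanges [p] and [m], so they have the same integral, and their mean
   is [g (B^2 + A^2)]. Averaging two nonnegative functions avoids integrating the signed product
   [A B]. *)
pose p (z : n.-tuple R) := g (enorm z) * (B z + A z) ^+ 2.
pose m (z : n.-tuple R) := g (enorm z) * (- B z + A z) ^+ 2.
have mp : measurable_fun setT p.
  by apply: measurable_funM => //; apply: measurable_funX; exact: measurable_funD.
have mm : measurable_fun setT m.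
  apply: measurable_funM => //; apply: measurable_funX; apply: measurable_funD => //.
  exact: measurable_funN.
have p0 z : 0 <= p z by rewrite mulr_ge0// sqr_ge0.
have m0 z : 0 <= m z by rewrite mulr_ge0// sqr_ge0.
have pm : intRd (fun z => (p z)%:E) = intRd (fun z => (m z)%:E).
  have mpE : measurable_fun setT (fun z => (p z)%:E) by exact/measurable_EFinP.
  have pE0 z : (0 <= (p z)%:E)%E by rewrite lee_fin.
  rewrite -(intRd_refl i mpE pE0).
  apply: eq_intRd => z; rewrite /p /m enorm_refl; congr (_ * (_ + _) ^+ 2)%:E.
    by rewrite /B tnth_mktuple eqxx mulNr.
  rewrite /A big_seq [RHS]big_seq; apply: eq_bigr => j js.
  by rewrite tnth_mktuple; case: eqP => // ji; rewrite -ji js in is_.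
rewrite (eq_intRd (g := fun z => (p z)%:E)); last first.
  by move=> z; rewrite big_cons.
have h0 : 0 <= 2^-1 :> R by rewrite invr_ge0.
have -> : intRd (fun z => (p z)%:E) =
    intRd (fun z => (2^-1 * p z + 2^-1 * m z)%:E).
  have mh (q : n.-tuple R -> R) : measurable_fun setT q ->
    measurable_fun setT (fun z => 2^-1 * q z) by move=> mq; exact: measurable_funM.
  have qh (q : n.-tuple R -> R) : (forall z, 0 <= q z) -> forall z, 0 <= 2^-1 * q z.
    by move=> q0 z; rewrite mulr_ge0.
  rewrite (intRdD (mh _ mp) (mh _ mm) (qh _ p0) (qh _ m0)).
  rewrite !intRdZ// -pm -ge0_muleDl ?lee_fin// -EFinD.
  by rewrite (_ : _ + _ = 1)%R ?mul1e//; field.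
rewrite -intRdD//.
- by apply: eq_intRd => z; rewrite /p /m /A /B; congr (_%:E); field.
- by apply: measurable_funM => //; exact: measurable_funX.
- by apply: measurable_funM => //; exact: measurable_funX.
- by move=> z; rewrite mulr_ge0// sqr_ge0.
- by move=> z; rewrite mulr_ge0// sqr_ge0.
Qed.

(** Once [i], respectively [j], is made the outermost variable, the two iterated integrals coincide
    literally. *)
Lemma intRd_radial_sqr (i j : 'I_n) :
  intRd (fun z : n.-tuple R => (g (enorm z) * tnth z i ^+ 2)%:E) =
  intRd (fun z : n.-tuple R => (g (enorm z) * tnth z j ^+ 2)%:E).
Proof.
have mf (k : 'I_n) : measurable_fun setT (fun z : n.-tuple R => (g (enorm z) * tnth z k ^+ 2)%:E).
  apply/measurable_EFinP; apply: measurable_funM => //; apply: measurable_funX.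
  exact: measurable_tnth.
have f0 (k : 'I_n) z : (0 <= (g (enorm z) * tnth z k ^+ 2)%:E)%E.
  by rewrite lee_fin mulr_ge0// sqr_ge0.
case: n i j mf f0 => [[]//|k] i j mf f0.
rewrite (intRd_ins i)// (intRd_ins j)//; apply: eq_integral => x _.
by apply: eq_intRd => t; rewrite !enorm_ins !tnth_ins.
Qed.

(** Both integrals are multiples of one diagonal moment [M]: by [|xi|^2] on the left, by [n] on the
    right. Keeping the factor [n] avoids a division by a dimension that may be [0], and [M] may be
    infinite. *)
Lemma intRd_radial_dot (xi : n.-tuple R) :
  (n%:R%:E * intRd (fun z => (g (enorm z) * dotRd z xi ^+ 2)%:E) =
   (dotRd xi xi)%:E * intRd (fun z : n.-tuple R => (g (enorm z) * enorm z ^+ 2)%:E))%E.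
Proof.
have mt i : measurable_fun setT (fun z : n.-tuple R => g (enorm z) * tnth z i ^+ 2).
  by apply: measurable_funM => //; apply: measurable_funX; exact: measurable_tnth.
have t0 i (z : n.-tuple R) : 0 <= g (enorm z) * tnth z i ^+ 2 by rewrite mulr_ge0// sqr_ge0.
have [n0|n0] := posnP n.
  rewrite /dotRd big1 => [|[i ltin]]; first by rewrite {1}n0 !mul0e.
  by exfalso; rewrite n0 in ltin.
pose i0 := Ordinal n0.
pose M := intRd (fun z : n.-tuple R => (g (enorm z) * tnth z i0 ^+ 2)%:E).
have M0 : (0 <= M)%E by apply: intRd_ge0 => z; rewrite lee_fin.
have -> : intRd (fun z : n.-tuple R => (g (enorm z) * enorm z ^+ 2)%:E) = (n%:R%:E * M)%E.
  transitivity (\sum_(i < n) (1%:E * M))%E; last first.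
    by rewrite -ge0_sume_distrl// sumEFin sumr_const card_ord.
  rewrite -(eq_intRd (f := fun z : n.-tuple R => (\sum_(i < n) g (enorm z) * tnth z i ^+ 2)%:E)).
    rewrite intRd_sum//; apply: eq_bigr => i _; rewrite mul1e; exact: intRd_radial_sqr.
  by move=> z; rewrite sqr_enorm /dotRd -mulr_sumr.
have -> : intRd (fun z : n.-tuple R => (g (enorm z) * dotRd z xi ^+ 2)%:E) = ((dotRd xi xi)%:E * M)%E.
  rewrite intRd_radial_sum_sqr ?index_enum_uniq//.
  rewrite /dotRd -sumEFin ge0_sume_distrl; last by move=> i _; rewrite lee_fin -expr2 sqr_ge0.
  apply: eq_bigr => i _; rewrite -expr2 /M (intRd_radial_sqr i0 i) -intRdZ ?sqr_ge0//.
  by apply: eq_intRd => z; congr (_%:E); ring.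
by rewrite muleCA.
Qed.
End second_moments.
End isotropy.

(** * Polar coordinates for radial integrands *)

Section polar.
Variable R : realType.
Local Notation leb1 := (@lebesgue_measure R).

Lemma measurable_invr : measurable_fun setT (@GRing.inv R).
Proof.
(* Reduces the inverse to a real power of a nonnegative number; at [0] both sides are [0] by
   convention. *)
rewrite (_ : GRing.inv = fun x : R => x * (x ^+ 2) `^ (-1)).
  apply: measurable_funM => //.
  by apply: (measurableT_comp (@measurable_powR R (-1))); exact: measurable_funX.
apply/funext => x; rewrite powR_inv1 ?sqr_ge0//.
have [->|x0] := eqVneq x 0; first by rewrite invr0 mul0r.
by field.
Qed.

Lemma intRd_integral_swap n (h : R * n.-tuple R -> \bar R) :
  measurable_fun setT h -> (forall p, 0 <= h p)%E ->
  intRd (fun z => \int[leb1]_r h (r, z))%E = (\int[leb1]_r intRd (fun z => h (r, z)))%E.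
Proof.
move=> mh h0.
have mG := @measurable_fun_fubini_tonelli_G _ _ _ _ _ leb1 h mh h0.
rewrite intRdE//; last by move=> z; apply: integral_ge0 => r _; exact: h0.
have := @fubini_tonelli _ _ _ _ _ leb1 (leb R n) h mh h0.
rewrite /fubini_F /fubini_G => <-.
apply: eq_integral => r _; rewrite intRdE//.
exact: (measurableT_comp mh (measurable_pair1 r)).
Qed.

(** The polar density [x^(n-1) g(x)] on [x > 0]; the quotient [x ^+ n / x] avoids a truncated
    predecessor in the exponent. *)
Definition radial_density n (g : R -> R) (x : R) : R := (0 < x)%R%:R * (g x * (x ^+ n / x)).

Lemma measurable_radial_density n g : measurable_fun setT g ->
  measurable_fun setT (radial_density n g).
Proof.
move=> mg; apply: measurable_funM.
  by apply: measurable_boolr; exact: measurable_fun_ltr.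
apply: measurable_funM => //; apply: measurable_funM; first exact: measurable_funX.
exact: measurable_invr.
Qed.

Lemma radial_density_ge0 n g x : (forall x, 0 <= g x) -> 0 <= radial_density n g x.
Proof.
move=> g0; rewrite /radial_density; case: ltP => x0; last by rewrite mul0r.
by rewrite mul1r mulr_ge0// divr_ge0// ?exprn_ge0// ltW.
Qed.

(* Both sides are the integral of [g |z| / |z|] over [0 < r <= |z|], computed in the
   two possible orders; integrating in [z] first, one substitutes [z = r w]. *)
Lemma intRd_radial_const n : exists2 C : \bar R, (0 <= C)%E &
  forall g : R -> R, measurable_fun setT g -> (forall x, 0 <= g x) -> g 0 = 0 ->
  (intRd (fun z : n.-tuple R => (g (enorm z))%:E) =
   C * \int[leb1]_x (radial_density n g x)%:E)%E.
Proof.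
(* After [z = r w] the constraint [r <= |z|] reads [1 <= |w|]. Expressing the integrand through
   [G (|w| r)] leaves [|w|^-n], and substituting in [r] gives one more [1 / |w|]. *)
pose c (w : n.-tuple R) : R := (1 <= enorm w)%R%:R * (enorm w ^- n / enorm w).
have c0 w : 0 <= c w by rewrite mulr_ge0// divr_ge0// ?invr_ge0 ?exprn_ge0// ?enorm_ge0.
exists (intRd (fun w => (c w)%:E)) => [|g mg g0 g00].
  by apply: intRd_ge0 => w; rewrite lee_fin.
pose k (y : R) : R := (0 < y)%R%:R * (y <= 1)%R%:R.
have k0 y : 0 <= k y by rewrite mulr_ge0.
have mk : measurable_fun setT k.
  by apply: measurable_funM; apply: measurable_boolr;
    [exact: measurable_fun_ltr|exact: measurable_fun_ler].
have ik : (\int[leb1]_y (k y)%:E = 1)%E.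
  have := @integral_powR01 R 1 ltr01; rewrite invr1 => <-.
  apply: eq_integral => y _; rewrite subrr powRr0 ?mulr1//.
have mnz : measurable_fun setT (fun p : R * n.-tuple R => enorm p.2).
  exact: (measurableT_comp (@measurable_enorm R n) measurable_snd).
have mnV : measurable_fun setT (fun p : R * n.-tuple R => (enorm p.2)^-1).
  exact: (measurableT_comp measurable_invr mnz).
pose h (p : R * n.-tuple R) : \bar R :=
  (g (enorm p.2) / enorm p.2 * k (p.1 / enorm p.2))%:E.
have mh : measurable_fun setT h.
  apply/measurable_EFinP; apply: measurable_funM.
    by apply: measurable_funM => //; exact: (measurableT_comp mg mnz).
  by apply: (measurableT_comp mk); exact: measurable_funM.
have h0 p : (0 <= h p)%E.
  by rewrite lee_fin mulr_ge0// divr_ge0// enorm_ge0.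
pose G := radial_density n g.
have mG : measurable_fun setT G by exact: measurable_radial_density.
have G0 x : 0 <= G x by exact: radial_density_ge0.
transitivity (intRd (fun z => \int[leb1]_r h (r, z)))%E.
  apply: eq_intRd => z; have := enorm_ge0 z; rewrite le_eqVlt => /predU1P[z0|z0].
    rewrite integral0_eq -?z0 ?g00// => x _.
    by rewrite /h/= -z0 g00 !mul0r.
  have mhz : measurable_fun setT (fun r => h (r, z)).
    exact: (measurableT_comp mh (measurable_pair2 z)).
  rewrite (integral_scaleR z0 mhz)//.
  under eq_integral do rewrite /h/= [enorm z * _]mulrC mulfK ?gt_eqF// EFinM.
  rewrite ge0_integralZl//= ?lee_fin ?divr_ge0 ?(ltW z0)//; last 2 first.
  - exact/measurable_EFinP.
  - by move=> y _; rewrite lee_fin.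
  by rewrite ik mule1 -EFinM mulrCA divff ?mulr1// gt_eqF.
rewrite intRd_integral_swap//.
(* This is [h] after the substitution, with the Jacobian [r ^+ n] already absorbed. *)
pose H (p : R * n.-tuple R) : \bar R :=
  ((1 <= enorm p.2)%R%:R * enorm p.2 ^- n * G (enorm p.2 * p.1))%:E.
have mH : measurable_fun setT H.
  apply/measurable_EFinP; apply: measurable_funM; last first.
    by apply: (measurableT_comp mG); apply: measurable_funM.
  apply: measurable_funM; last first.
    apply: (measurableT_comp measurable_invr).
    exact: measurable_funX.
  by apply: measurable_boolr; exact: measurable_fun_ler.
have H0 p : (0 <= H p)%E.
  rewrite lee_fin; apply: mulr_ge0 => //; apply: mulr_ge0 => //.
  by rewrite invr_ge0 exprn_ge0// enorm_ge0.
transitivity (\int[leb1]_r intRd (fun w => H (r, w)))%E.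
  apply: eq_integral => r _; have [r0|r0] := ltP 0 r; last first.
    rewrite (_ : (fun z => h (r, z)) = cst 0%E); last first.
      apply/funext => z; rewrite /h/= /k ltNge mulr_le0_ge0 ?invr_ge0 ?enorm_ge0//=.
      by rewrite mul0r mulr0.
    rewrite (_ : (fun z => H (r, z)) = cst 0%E)//.
    apply/funext => z; rewrite /H/= /G /radial_density ltNge mulr_ge0_le0 ?enorm_ge0//=.
    by rewrite mul0r mulr0.
  have mhr : measurable_fun setT (fun z => h (r, z)).
    exact: (measurableT_comp mh (measurable_pair1 r)).
  have hr0 z : (0 <= h (r, z))%E by exact: h0.
  rewrite (intRd_scale r0 mhr hr0).
  have -> : (fun t => h (r, scaleT r t)) = (fun t => (r ^- n * fine (H (r, t)))%:E).
    apply/funext => w; rewrite /h /H/= enorm_scaleT ?(ltW r0)// /G /radial_density /k.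
    have := enorm_ge0 w; rewrite le_eqVlt => /predU1P[w0|w0].
      by rewrite -w0 ler10 !(mul0r, mulr0, invr0).
    have rn0 : r != 0 by rewrite gt_eqF.
    have wn0 : enorm w != 0 by rewrite gt_eqF.
    have -> : r / (r * enorm w) = (enorm w)^-1 by field; rewrite rn0 wn0.
    rewrite invr_gt0 w0 pmulr_rgt0// r0 invf_le1//; congr (_%:E).
    case: (1 <= _); rewrite ?(mulr0, mul0r)// !(mul1r, mulr1) mulrC [enorm w * r]mulrC exprMn.
    by field; rewrite rn0 wn0 !expf_neq0.
  rewrite intRdZ; last 3 first.
  - by rewrite invr_ge0 exprn_ge0// ltW.
  - have := measurableT_comp mH (measurable_pair1 r).
    by move=> /measurable_EFinP.
  - by move=> w; have := H0 (r, w); rewrite lee_fin.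
  by rewrite muleA -EFinM divff ?mul1e// expf_neq0// gt_eqF.
rewrite -intRd_integral_swap//.
have mc : measurable_fun setT (fun w => (c w)%:E).
  apply/measurable_EFinP; apply: measurable_funM.
    by apply: measurable_boolr; apply: measurable_fun_ler => //; exact: measurable_enorm.
  apply: measurable_funM; apply: (measurableT_comp measurable_invr); last exact: measurable_enorm.
  by apply: measurable_funX; exact: measurable_enorm.
have GE0 : (0 <= \int[leb1]_x (G x)%:E)%E by apply: integral_ge0 => x _; rewrite lee_fin.
have cE0 w : (0 <= (c w)%:E)%E by rewrite lee_fin.
transitivity (intRd (fun w => (c w)%:E * \int[leb1]_x (G x)%:E)%E); last first.
  rewrite (intRdE mc cE0) -ge0_integralZr//.
  rewrite intRdE// => [|w]; last exact: mule_ge0.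
  by apply: emeasurable_funM.
apply: eq_intRd => w; have [w1|w1] := leP 1 (enorm w); last first.
  rewrite integral0_eq /c ?leNgt ?w1/= ?mul0r ?mul0e// => x _.
  by rewrite /H/= leNgt w1 !mul0r.
have w0 : 0 < enorm w by exact: lt_le_trans w1.
have mGw : measurable_fun setT (fun x => (G (enorm w * x))%:E).
  by apply/measurable_EFinP; apply: (measurableT_comp mG); exact: measurable_funM.
rewrite (@integral_scaleR _ (enorm w) (fun x => (G x)%:E))//; last exact/measurable_EFinP.
rewrite muleA -EFinM /c w1 mul1r divfK ?gt_eqF//.
under eq_integral do rewrite /H/= w1 mul1r EFinM.
rewrite ge0_integralZl//=.
- by move=> x _; rewrite lee_fin.
- by rewrite lee_fin invr_ge0 exprn_ge0// ltW.
Qed.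

(** The constant of [intRd_radial_const] is the same for all [g], so one test function identifies
    it: the indicator of []0, 1]] has integral [unit_ball_vol] on the left and [1 / n] on the radial
    side. *)
Lemma intRd_radial n (g : R -> R) : (0 < n)%N ->
  measurable_fun setT g -> (forall x, 0 <= g x) -> g 0 = 0 ->
  (intRd (fun z : n.-tuple R => (g (enorm z))%:E) =
   (n%:R * unit_ball_vol R n)%:E * \int[leb1]_x (radial_density n g x)%:E)%E.
Proof.
move=> n0 mg g0 g00; have [C C0 CE] := intRd_radial_const n.
rewrite CE//; congr (_ * _)%E.
pose k (y : R) : R := (0 < y)%R%:R * (y <= 1)%R%:R.
have k0 y : 0 <= k y by rewrite mulr_ge0.
have mk : measurable_fun setT k.
  by apply: measurable_funM; apply: measurable_boolr;
    [exact: measurable_fun_ltr|exact: measurable_fun_ler].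
have := CE k mk k0; rewrite /k ltxx mul0r => /(_ erefl).
rewrite punctured_ball_vol//.
have -> : (\int[leb1]_x (radial_density n k x)%:E = (n%:R^-1)%:E)%E.
  have nR : 0 < n%:R :> R by rewrite ltr0n.
  rewrite -(integral_powR01 nR); apply: eq_integral => x _.
  rewrite /radial_density /k; case: ltP => x0; last by rewrite !mul0r.
  rewrite !mul1r; congr (_ * _)%:E.
  rewrite powRB; last by rewrite (gt_eqF x0) implybT.
  by rewrite powRr1 ?ltW// powR_mulrn// ltW.
move=> VE; rewrite EFinM VE muleC -muleA -EFinM mulVf ?mule1//.
by rewrite pnatr_eq0 gtn_eqF.
Qed.

End polar.

(** * Taylor bounds for sine and cosine; Cauchy-Schwarz *)

Section cosine_bounds.
Variable R : realType.

(** One rung of a ladder: in the four bounds below, the derivative of each Taylor remainder is the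
    preceding remainder, starting from [1 - cos]. *)
Lemma ge0_of_derive_ge0 (f df : R -> R) : (forall x : R, is_derive x 1 f (df x)) ->
  f 0 = 0 -> (forall x, 0 <= x -> 0 <= df x) -> forall x, 0 <= x -> 0 <= f x.
Proof.
move=> dfP f0 df0 x x0.
have cf : {within `[0, x], continuous f}.
  apply: continuous_subspaceT => y; apply: differentiable_continuous.
  by apply/derivable1_diffP; have := dfP y.
have [c] := MVT_segment x0 (fun y _ => dfP y) cf.
rewrite in_itv/= => /andP[c0 _]; rewrite f0 !subr0 => ->.
by rewrite mulr_ge0// df0.
Qed.

Lemma sin_le_id (x : R) : 0 <= x -> sin x <= x.
Proof.
move=> x0; rewrite -subr_ge0.
have dF (y : R) : is_derive y 1 (fun x => x - sin x) (1 - cos y).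
  by apply: is_derive_eq.
apply: (ge0_of_derive_ge0 dF) x0 => [|y _]; first by rewrite sin0 subrr.
by rewrite subr_ge0 cos_le1.
Qed.

Lemma cos_ge_quad (x : R) : 1 - x ^+ 2 / 2 <= cos x.
Proof.
wlog x0 : x / 0 <= x.
  move=> H; have [|/ltW x0] := leP 0 x; first exact: H.
  by rewrite -sqrrN -cosN; apply: H; rewrite oppr_ge0.
have dF (y : R) : is_derive y 1 (fun x => cos x - (1 - 2^-1 * x ^+ 2)) (y - sin y).
  apply: is_derive_eq.
  by rewrite /GRing.scale/=; field.
rewrite -subr_ge0 [_ / _]mulrC.
apply: (ge0_of_derive_ge0 dF) x0 => [|y y0].
  by rewrite cos0 expr0n/= mulr0 subr0 subrr.
by rewrite subr_ge0 sin_le_id.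
Qed.

Lemma sin_ge_cubic (x : R) : 0 <= x -> x - x ^+ 3 / 6 <= sin x.
Proof.
move=> x0.
have dF (y : R) : is_derive y 1 (fun x => sin x - (x - 6^-1 * x ^+ 3)) (cos y - (1 - y ^+ 2 / 2)).
  apply: is_derive_eq.
  by rewrite /GRing.scale/=; field.
rewrite -subr_ge0 [_ / _]mulrC.
apply: (ge0_of_derive_ge0 dF) x0 => [|y y0].
  by rewrite sin0 expr0n/= mulr0 !subr0.
by rewrite subr_ge0 cos_ge_quad.
Qed.

Lemma cos_le_quartic (x : R) : cos x <= 1 - x ^+ 2 / 2 * (1 - x ^+ 2 / 12).
Proof.
wlog x0 : x / 0 <= x.
  move=> H; have [|/ltW x0] := leP 0 x; first exact: H.
  by rewrite -(cosN x) -(sqrrN x); apply: H; rewrite oppr_ge0.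
have dF (y : R) : is_derive y 1 (fun x => 1 - 2^-1 * x ^+ 2 + 24^-1 * x ^+ 4 - cos x)
    (sin y - (y - y ^+ 3 / 6)).
  apply: is_derive_eq.
  by rewrite /GRing.scale/=; field.
rewrite -subr_ge0 (_ : _ - _ = 1 - 2^-1 * x ^+ 2 + 24^-1 * x ^+ 4 - cos x); last by field.
apply: (ge0_of_derive_ge0 dF) x0 => [|y y0].
  by rewrite cos0 !expr0n/= !mulr0 subr0 addr0 subrr.
by rewrite subr_ge0 sin_ge_cubic.
Qed.

Lemma dotRd_sqr_le n (x y : n.-tuple R) : dotRd x y ^+ 2 <= enorm x ^+ 2 * enorm y ^+ 2.
Proof.
rewrite !sqr_enorm.
have [y0|y0] := eqVneq (dotRd y y) 0.
  rewrite (_ : dotRd x y = 0) ?expr0n ?y0 ?mulr0//.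
  have /eqP : dotRd y y = 0 by [].
  rewrite /dotRd psumr_eq0 => [|i _]; last by rewrite -expr2 sqr_ge0.
  move=> /allP yi; apply: big1 => i _.
  by have := yi i (mem_index_enum i); rewrite /= mulf_eq0 orbb => /eqP ->; rewrite mulr0.
have {}y0 : 0 < dotRd y y by rewrite lt_neqAle eq_sym y0 dotRdd_ge0.
rewrite -(ler_pM2l y0) -subr_ge0.
(* The expansion of [|(y.y) x - (x.y) y|^2] equals [y.y] times the Cauchy-Schwarz defect. *)
have : 0 <= \sum_(i < n) (dotRd y y * tnth x i - dotRd x y * tnth y i) ^+ 2.
  by apply: sumr_ge0 => i _; rewrite sqr_ge0.
congr (_ <= _).
under eq_bigr => i _.
  rewrite (_ : _ ^+ 2 = dotRd y y ^+ 2 * (tnth x i * tnth x i)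
    - (2 * dotRd y y * dotRd x y) * (tnth x i * tnth y i)
    + dotRd x y ^+ 2 * (tnth y i * tnth y i)); last by ring.
  over.
rewrite !big_split/= sumrN -!mulr_sumr -/(dotRd x x) -/(dotRd x y) -/(dotRd y y).
ring.
Qed.

End cosine_bounds.

(** * Two-sided bounds on the dispersion relation *)

Section dispersion_relation.
Variables (R : realType) (d : nat) (kappa alpha : R) (chi : R -> R).
Hypotheses (d_gt0 : (0 < d)%N) (kappa_gt0 : 0 < kappa).
Hypothesis alpha_lt1 : alpha < 1.
Hypothesis mchi : measurable_fun setT chi.
Hypothesis chi01 : forall r, 0 <= chi r <= 1.
Hypothesis chi_out : forall r, 1 < `|r| -> chi r = 0.
Hypothesis chi_in : forall r, `|r| <= 2^-1 -> chi r = 1.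

Local Notation leb1 := (@lebesgue_measure R).
Local Notation V := (unit_ball_vol R d).
Local Notation p := (2 - 2 * alpha).

Let p_gt0 : 0 < p. Proof. by rewrite subr_gt0 gtr_pMr. Qed.

Let chi_ge0 r : 0 <= chi r. Proof. by have /andP[] := chi01 r. Qed.

(** The weight [x^(1 - 2 alpha)] is what remains of the radial density [x^(d-1)] times
    [x^2 / x^(d + 2 alpha)]. *)
Definition moment (phi : R -> R) : \bar R :=
  (\int[leb1]_x ((0 < x)%R%:R * (phi x * x `^ (1 - 2 * alpha)))%:E)%E.

Let measurable_moment (phi : R -> R) : measurable_fun setT phi ->
  measurable_fun setT (fun x : R => (0 < x)%R%:R * (phi x * x `^ (1 - 2 * alpha))).
Proof.
move=> mphi; apply: measurable_funM.
  by apply: measurable_boolr; exact: measurable_fun_ltr.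
by apply: measurable_funM => //; exact: measurable_powR.
Qed.

Let moment_pos (phi : R -> R) x : (forall x, 0 <= phi x) ->
  0 <= (0 < x)%R%:R * (phi x * x `^ (1 - 2 * alpha)) :> R.
Proof. by move=> phi0; rewrite mulr_ge0// mulr_ge0// powR_ge0. Qed.

Lemma moment_ge0 phi : (forall x, 0 <= phi x) -> (0 <= moment phi)%E.
Proof. by move=> phi0; apply: integral_ge0 => x _; rewrite lee_fin moment_pos. Qed.

(** Isotropy divides by [d], polar coordinates multiply by [d V]: only the ball volume [V] survives,
    as in [gamma_const]. *)
Lemma intRd_second_moment (phi : R -> R) (xi : d.-tuple R) :
  measurable_fun setT phi -> (forall x, 0 <= phi x) ->
  (intRd (fun y => (phi (enorm y) / enorm y `^ (d%:R + 2 * alpha) * dotRd y xi ^+ 2)%:E) =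
   (V * enorm xi ^+ 2)%:E * moment phi)%E.
Proof.
move=> mphi phi0.
pose g (x : R) := phi x / x `^ (d%:R + 2 * alpha).
have mg : measurable_fun setT g.
  apply: measurable_funM => //; apply: (measurableT_comp (@measurable_invr R)).
  exact: measurable_powR.
have g0 x : 0 <= g x by rewrite divr_ge0// powR_ge0.
have := intRd_radial_dot mg g0 xi.
pose g2 (x : R) := g x * x ^+ 2.
rewrite (@intRd_radial _ _ g2)//; last 3 first.
- by apply: measurable_funM => //; exact: measurable_funX.
- by move=> x; rewrite mulr_ge0// sqr_ge0.
- by rewrite /g2 expr0n mulr0.
have -> : (\int[leb1]_x (radial_density d g2 x)%:E = moment phi)%E.
  apply: eq_integral => x _; rewrite /radial_density /g2 /g.
  case: ltP => x0; last by rewrite !mul0r.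
  congr (_ * _)%:E; rewrite -!mulrA; congr (_ * _).
  have xn0 : x != 0 by rewrite gt_eqF.
  have xp0 : x `^ (d%:R + 2 * alpha) != 0 by rewrite gt_eqF// powR_gt0.
  have : x `^ (1 - 2 * alpha) * x `^ (d%:R + 2 * alpha) = x ^+ d * x.
    rewrite -powRD ?xn0 ?implybT//.
    rewrite (_ : 1 - 2 * alpha + (d%:R + 2 * alpha) = d.+1%:R); first by rewrite powR_mulrn ?(ltW x0)// exprSr.
    by rewrite -natr1; ring.
  move=> /(canRL (mulfK xp0)) ->; field.
  by rewrite xn0 xp0.
have dn0 : d%:R != 0 :> R by rewrite pnatr_eq0 gtn_eqF.
move=> /(congr1 (mule (d%:R^-1)%:E)).
rewrite muleA -EFinM mulVf// mul1e => ->.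
by rewrite !muleA -!EFinM -sqr_enorm; congr (_%:E * _)%E; field.
Qed.

(** With [r = delta], this is the power of [delta] that the prefactor of [omega] cancels. *)
Lemma moment_scale (phi : R -> R) (r : R) : 0 < r ->
  measurable_fun setT phi -> (forall x, 0 <= phi x) ->
  (moment (fun x => phi (x / r)%R) = (r `^ p)%:E * moment phi)%E.
Proof.
move=> r0 mphi phi0; rewrite /moment (integral_scaleR r0); last 2 first.
- apply/measurable_EFinP; apply: measurable_moment.
  by apply: (measurableT_comp mphi); exact: measurable_funM.
- by move=> x; rewrite lee_fin (moment_pos (phi := fun x => phi (x / r))).
have rp0 : 0 <= r `^ (1 - 2 * alpha) by exact: powR_ge0.
transitivity (r%:E * ((r `^ (1 - 2 * alpha))%:E * moment phi))%E; last first.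
  rewrite muleA -EFinM; congr (_%:E * _)%E.
  rewrite -[X in X * _]powRr1 ?(ltW r0)// -powRD ?(gt_eqF r0) ?implybT//.
  by congr (_ `^ _); ring.
congr (_ * _)%E.
rewrite -ge0_integralZl//=; first last.
- by move=> x _; rewrite lee_fin; apply: moment_pos.
- by apply/measurable_EFinP; exact: measurable_moment.
apply: eq_integral => x _; rewrite -EFinM; congr (_%:E).
rewrite pmulr_rgt0// [r * x]mulrC mulfK ?gt_eqF//.
case: ltP => x0; last by rewrite !mul0r mulr0.
by rewrite (powRM _ (ltW x0) (ltW r0)); ring.
Qed.

Lemma moment_itv r : 0 < r ->
  moment (fun x => (x <= r)%R%:R) = (r `^ p / p)%:E.
Proof.
move=> r0; rewrite -(integral_powR_itv p_gt0 r0); apply: eq_integral => x _.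
by rewrite mulrA (_ : 1 - 2 * alpha = p - 1)//; ring.
Qed.

Definition chi_moment := fine (moment chi).

Lemma chi_momentE : moment chi = chi_moment%:E.
Proof.
rewrite /chi_moment fineK// ge0_fin_numE; last exact: moment_ge0.
apply: (@le_lt_trans _ _ (moment (fun x => (x <= 1)%R%:R))).
  apply: le_ge0_integral => x; rewrite lee_fin; first exact: moment_pos.
  case: ltP => x0; last by rewrite !mul0r.
  rewrite !mul1r ler_wpM2r ?powR_ge0//.
  have [x1|x1] := leP x 1; first by have /andP[] := chi01 x.
  by rewrite chi_out// gtr0_norm.
by rewrite moment_itv// ltry.
Qed.

Lemma gamma_constE : gamma_const d kappa alpha chi = Num.sqrt (kappa / 2 * V * chi_moment).
Proof.
rewrite /gamma_const; congr (Num.sqrt (_ * fine _)).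
have mf : measurable_fun setT (fun x : R => (chi x * x `^ (1 - 2 * alpha))%:E).
  apply/measurable_EFinP; apply: measurable_funM => //; exact: measurable_powR.
(* The moment lives on [x > 0] and [gamma_const] on [[0, 1]]: the endpoint [0] is null, and [chi]
   vanishes beyond [1]. *)
rewrite -integral_itv_obnd_cbnd; last exact: measurable_funTS.
rewrite /moment integral_mkcond; apply: eq_integral => x _; rewrite patchE mem_setE in_itv/=.
case: ltP => x0 /=; last by rewrite mul0r.
rewrite mul1r; have [//|x1] := leP x 1.
by rewrite chi_out ?mul0r// gtr0_norm.
Qed.

Local Notation gam := (gamma_const d kappa alpha chi).

Lemma chi_moment_ge0 : 0 <= chi_moment.
Proof. by rewrite fine_ge0// moment_ge0. Qed.

Lemma sqr_gamma_const : gam ^+ 2 = kappa / 2 * V * chi_moment.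
Proof.
rewrite gamma_constE sqr_sqrtr// mulr_ge0 ?chi_moment_ge0// mulr_ge0 ?divr_ge0 ?(ltW kappa_gt0)//.
exact/ltW/unit_ball_vol_gt0.
Qed.

Lemma gamma_const_ge0 : 0 <= gam. Proof. exact: sqrtr_ge0. Qed.

(** The integral inside [omega] before [fine]; bounds are proved in the extended reals, and the
    upper one yields finiteness. *)
Definition symbol_integral (delta : R) (xi : d.-tuple R) : \bar R :=
  intRd (fun y : d.-tuple R =>
    (chi (enorm y / delta) * (1 - cos (dotRd y xi)) / enorm y `^ (d%:R + 2 * alpha))%:E).

Let symbol_integrand_ge0 delta xi (y : d.-tuple R) :
  0 <= chi (enorm y / delta) * (1 - cos (dotRd y xi)) / enorm y `^ (d%:R + 2 * alpha).
Proof. by rewrite divr_ge0 ?powR_ge0// mulr_ge0// subr_ge0 cos_le1. Qed.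

Lemma symbol_integral_ge0 delta xi : (0 <= symbol_integral delta xi)%E.
Proof. by apply: intRd_ge0 => y; rewrite lee_fin. Qed.

Let measurable_kernel (phi : R -> R) (xi : d.-tuple R) : measurable_fun setT phi ->
  measurable_fun setT (fun y : d.-tuple R =>
    phi (enorm y) / enorm y `^ (d%:R + 2 * alpha) * dotRd y xi ^+ 2).
Proof.
move=> mphi; have mn := @measurable_enorm R d.
apply: measurable_funM; last by apply: measurable_funX; exact: measurable_dotRd.
apply: measurable_funM; first exact: (measurableT_comp mphi mn).
apply: (measurableT_comp (@measurable_invr R)).
exact: (measurableT_comp (@measurable_powR R _) mn).
Qed.

Let kernel_ge0 (phi : R -> R) (xi y : d.-tuple R) : (forall x, 0 <= phi x) ->
  0 <= phi (enorm y) / enorm y `^ (d%:R + 2 * alpha) * dotRd y xi ^+ 2.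
Proof. by move=> phi0; rewrite mulr_ge0 ?sqr_ge0// divr_ge0// powR_ge0. Qed.

Lemma intRd_second_momentZ c (phi : R -> R) (xi : d.-tuple R) : 0 <= c ->
  measurable_fun setT phi -> (forall x, 0 <= phi x) ->
  (intRd (fun y => (c * (phi (enorm y) / enorm y `^ (d%:R + 2 * alpha) * dotRd y xi ^+ 2))%:E) =
   (c * (V * enorm xi ^+ 2))%:E * moment phi)%E.
Proof.
move=> c0 mphi phi0; rewrite intRdZ//.
- by rewrite intRd_second_moment// muleA -EFinM.
- exact: measurable_kernel.
- by move=> y; exact: kernel_ge0.
Qed.

Let mchi_scale delta : measurable_fun setT (fun x : R => chi (x / delta)).
Proof. by apply: (measurableT_comp mchi); exact: measurable_funM. Qed.

Lemma symbol_integral_le delta xi : 0 < delta ->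
  (symbol_integral delta xi <=
   (2^-1 * (V * enorm xi ^+ 2) * (delta `^ p * chi_moment))%:E)%E.
Proof.
move=> delta0.
rewrite EFinM (EFinM (delta `^ p)) -chi_momentE -moment_scale// -intRd_second_momentZ ?invr_ge0//.
apply: le_intRd => y; rewrite lee_fin//.
rewrite [leRHS](_ : _ = chi (enorm y / delta) * (dotRd y xi ^+ 2 / 2) /
  enorm y `^ (d%:R + 2 * alpha)); last by ring.
rewrite ler_wpM2r ?invr_ge0 ?powR_ge0// ler_wpM2l//.
by rewrite lerBlDr addrC -lerBlDr cos_ge_quad.
Qed.

Lemma symbol_integral_fin delta xi : 0 < delta ->
  symbol_integral delta xi = (fine (symbol_integral delta xi))%:E.
Proof.
move=> delta0; rewrite fineK// ge0_fin_numE ?symbol_integral_ge0//.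
by apply: le_lt_trans (symbol_integral_le xi delta0) _; rewrite ltry.
Qed.

Lemma sqr_omega delta (xi : d.-tuple R) : 0 < delta ->
  omega kappa alpha chi delta xi ^+ 2 =
  kappa / delta `^ p * fine (symbol_integral delta xi).
Proof.
move=> delta0; rewrite /omega sqr_sqrtr.
  by rewrite (_ : 2 * (1 - alpha) = p)//; ring.
by rewrite mulr_ge0 ?fine_ge0 ?symbol_integral_ge0// divr_ge0 ?powR_ge0// ltW.
Qed.

Lemma omega_ge0 delta (xi : d.-tuple R) : 0 <= omega kappa alpha chi delta xi.
Proof. exact: sqrtr_ge0. Qed.

Lemma omega_le delta (xi : d.-tuple R) : 0 < delta ->
  omega kappa alpha chi delta xi <= gam * enorm xi.
Proof.
move=> delta0.
rewrite -ler_sqr ?nnegrE ?omega_ge0 ?mulr_ge0 ?gamma_const_ge0 ?enorm_ge0//.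
rewrite sqr_omega// exprMn sqr_gamma_const.
have dp0 : 0 < delta `^ p by rewrite powR_gt0.
rewrite mulrAC ler_pdivrMr//.
have := symbol_integral_le xi delta0; rewrite symbol_integral_fin// lee_fin.
rewrite -(ler_pM2l kappa_gt0) => /le_trans; apply.
by rewrite le_eqVlt; apply/orP; left; apply/eqP; ring.
Qed.

Lemma omega_ge_small delta (xi : d.-tuple R) : 0 < delta -> delta * enorm xi <= 1 ->
  (gam * enorm xi) ^+ 2 * (1 - (delta * enorm xi) ^+ 2 / 12) <=
  omega kappa alpha chi delta xi ^+ 2.
Proof.
move=> delta0 dxi.
have dxi0 : 0 <= delta * enorm xi by rewrite mulr_ge0 ?enorm_ge0// ltW.
have dxi2 : (delta * enorm xi) ^+ 2 <= 1 by rewrite expr_le1.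
rewrite sqr_omega// exprMn sqr_gamma_const.
(* On the support of the kernel [|y| <= delta], so [(y.xi)^2 <= (delta |xi|)^2] and the quartic
   bound loses at most the factor [e], uniformly in [y]. *)
set e := 1 - _.
have e0 : 0 <= e by rewrite /e; lra.
have dp0 : 0 < delta `^ p by rewrite powR_gt0.
have : ((e / 2 * (V * enorm xi ^+ 2) * (delta `^ p * chi_moment))%:E <=
    symbol_integral delta xi)%E.
  rewrite EFinM (EFinM (delta `^ p)) -chi_momentE -moment_scale// -intRd_second_momentZ ?divr_ge0//.
  apply: le_intRd => y; rewrite lee_fin.
    by rewrite mulr_ge0 ?divr_ge0//; apply: (@kernel_ge0 (fun x => chi (x / delta))).
  rewrite [leLHS](_ : _ = chi (enorm y / delta) * (e / 2 * dotRd y xi ^+ 2) /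
    enorm y `^ (d%:R + 2 * alpha)); last by ring.
  rewrite ler_wpM2r ?invr_ge0 ?powR_ge0//.
  have [yd|yd] := leP (enorm y) delta; last first.
    rewrite chi_out ?mul0r// gtr0_norm; last by rewrite divr_gt0// (lt_trans delta0).
    by rewrite ltr_pdivlMr// mul1r.
  rewrite ler_wpM2l//; have := cos_le_quartic (dotRd y xi).
  have : dotRd y xi ^+ 2 <= (delta * enorm xi) ^+ 2.
    apply: le_trans (dotRd_sqr_le y xi) _; rewrite exprMn ler_wpM2r ?sqr_ge0//.
    by rewrite ler_sqr ?nnegrE ?enorm_ge0// ltW.
  have := sqr_ge0 (dotRd y xi); rewrite /e.
  move: (dotRd y xi ^+ 2) ((delta * enorm xi) ^+ 2) (cos _) => a b c a0 ab ca.
  nra.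
rewrite symbol_integral_fin// lee_fin -(ler_pM2l kappa_gt0) => eW.
rewrite [leRHS]mulrAC ler_pdivlMr//; apply: le_trans eW.
by rewrite le_eqVlt; apply/orP; left; apply/eqP; ring.
Qed.

(* Only the region [enorm y <= r] with [r = min (delta / 2) (1 / enorm xi)] is kept:
   there [chi = 1] and the argument of the cosine is at most [1]. *)
Lemma omega_ge_large : exists2 c : R, 0 < c & forall delta (xi : d.-tuple R),
  0 < delta <= 1 -> 1 <= enorm xi ->
  c * enorm xi `^ (2 * alpha) <= omega kappa alpha chi delta xi ^+ 2.
Proof.
have V0 := unit_ball_vol_gt0 R d.
have h0 : 0 < 2^-1 :> R by rewrite invr_gt0.
have hp0 : 0 < 2^-1 `^ p :> R by rewrite powR_gt0.
(* The [4] comes from [1 - cos x >= x^2 / 4] for [|x| <= 1], the [p] from the moment [r^p / p] of a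
   ball, and [2^-p] from the case [r = delta / 2]. *)
pose c := kappa * V / (4 * p) * 2^-1 `^ p.
have c0 : 0 < c by rewrite mulr_gt0// divr_gt0// mulr_gt0.
exists c => // delta xi /andP[delta0 delta1] xi1.
have xi0 : 0 < enorm xi by exact: lt_le_trans xi1.
have dp0 : 0 < delta `^ p by rewrite powR_gt0.
have key r : 0 < r -> r <= delta / 2 -> r * enorm xi <= 1 ->
    kappa * V / (4 * p) * enorm xi ^+ 2 * (r `^ p / delta `^ p) <=
    omega kappa alpha chi delta xi ^+ 2.
  move=> r0 rd rxi; rewrite sqr_omega//.
  have : ((4^-1 * (V * enorm xi ^+ 2) * (r `^ p / p))%:E <= symbol_integral delta xi)%E.
    rewrite EFinM -moment_itv// -intRd_second_momentZ ?invr_ge0//; last first.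
      by apply: measurable_boolr; exact: measurable_fun_ler.
    apply: le_intRd => y; rewrite lee_fin.
      by rewrite mulr_ge0 ?invr_ge0//; apply: (@kernel_ge0 (fun x => (x <= r)%R%:R)).
    have [yr|yr] := leP (enorm y) r; last by rewrite !mul0r mulr0.
    rewrite chi_in; last first.
      rewrite ger0_norm; last by rewrite divr_ge0 ?enorm_ge0// ltW.
      by rewrite ler_pdivrMr// mulrC; exact: le_trans rd.
    rewrite /= [leLHS](_ : _ = 1 * (4^-1 * dotRd y xi ^+ 2) /
      enorm y `^ (d%:R + 2 * alpha)); last by ring.
    rewrite ler_wpM2r ?invr_ge0 ?powR_ge0// !mul1r.
    have := cos_le_quartic (dotRd y xi).
    have : dotRd y xi ^+ 2 <= 1.
      apply: le_trans (dotRd_sqr_le y xi) _; rewrite -exprMn expr_le1 ?mulr_ge0 ?enorm_ge0//.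
      by apply: le_trans rxi; rewrite ler_wpM2r// enorm_ge0.
    have := sqr_ge0 (dotRd y xi).
    move: (dotRd y xi ^+ 2) (cos _) => a b a0 a1 ba.
    nra.
  rewrite symbol_integral_fin// lee_fin -(ler_pM2l kappa_gt0) => eW.
  rewrite [leRHS]mulrAC ler_pdivlMr//; apply: le_trans eW.
  rewrite le_eqVlt; apply/orP; left; apply/eqP; field.
  by rewrite !gt_eqF.
(* For [r = delta / 2] the ratio [r^p / delta^p] is [2^-p], and [|xi|^2 >= |xi|^(2 alpha)]. For
   [r = 1 / |xi|] the product [r^p |xi|^2] is exactly [|xi|^(2 alpha)], and
   [delta^-p >= 1 >= 2^-p]. *)
have [xid|xid] := leP (delta / 2) (enorm xi)^-1.
  have d20 : 0 < delta / 2 by rewrite divr_gt0.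
  apply: le_trans (key (delta / 2) d20 (lexx _) _); last first.
    by rewrite -ler_pdivlMr// mul1r.
  rewrite (powRM _ (ltW delta0) (ltW h0)) [delta `^ p * _]mulrC mulfK ?gt_eqF// /c -mulrA.
  rewrite -[leRHS]mulrA ler_wpM2l ?divr_ge0 ?mulr_ge0 ?(ltW kappa_gt0) ?(ltW V0) ?(ltW p_gt0)//.
  rewrite mulrC ler_wpM2r ?(ltW hp0)// -powR_mulrn ?enorm_ge0//.
  by rewrite ler_powR// ger_pMr// ltW.
have xiV0 : 0 < (enorm xi)^-1 by rewrite invr_gt0.
apply: le_trans (key _ xiV0 (ltW xid) _); last by rewrite mulVf ?gt_eqF.
rewrite -(powR_mulrn 2 (enorm_ge0 xi)) -(powR_inv1 (enorm_ge0 xi)) -powRrM.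
rewrite -[leRHS]mulrA [X in _ <= _ * X]mulrA -powRD ?(gt_eqF xi0) ?implybT//.
rewrite (_ : 2%:R + -1 * p = 2 * alpha); last by lra.
rewrite /c -mulrA ler_wpM2l ?divr_ge0 ?mulr_ge0 ?(ltW kappa_gt0) ?(ltW V0) ?(ltW p_gt0)//.
rewrite mulrC ler_wpM2l ?powR_ge0//.
have one_p : 1 `^ p = 1 :> R by rewrite powR1.
have hp1 : 2^-1 `^ p <= 1 :> R.
  rewrite -[leRHS]one_p; apply: ge0_ler_powR; rewrite ?nnegrE ?(ltW p_gt0) ?(ltW h0)//.
  by rewrite invf_le1// ler1n.
apply: le_trans hp1 _; rewrite -[leLHS]invr1 lef_pV2 ?posrE//.
by rewrite -[leRHS]one_p; apply: ge0_ler_powR; rewrite ?nnegrE ?(ltW p_gt0) ?(ltW delta0).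
Qed.

End dispersion_relation.

(** * Fourier multipliers of the solution and of its time derivative *)

Section multipliers.
Variable R : realType.

Lemma dist_le_of_derive (f df : R -> R) (K a b : R) : (forall x : R, is_derive x 1 f (df x)) ->
  a <= b -> (forall x, a <= x <= b -> `|df x| <= K) -> `|f b - f a| <= K * (b - a).
Proof.
move=> dfP ab dfK.
have cf : {within `[a, b], continuous f}.
  apply: continuous_subspaceT => y; apply: differentiable_continuous.
  by apply/derivable1_diffP; have := dfP y.
have [x] := MVT_segment ab (fun y _ => dfP y) cf.
rewrite in_itv/= => xab ->; rewrite normrM [X in _ * X]ger0_norm ?subr_ge0//.
by rewrite ler_wpM2r ?subr_ge0// dfK.
Qed.

Lemma dist_cos_le (x y : R) : `|cos x - cos y| <= `|x - y|.
Proof.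
wlog xy : x y / y <= x.
  move=> H; have [|/ltW yx] := leP y x; first exact: H.
  by rewrite distrC [leRHS]distrC; exact: H.
rewrite [leRHS]ger0_norm ?subr_ge0// -[leRHS]mul1r.
apply: (dist_le_of_derive (fun x => is_derive_cos x)) => // z _.
by rewrite normrN sin_max.
Qed.

Lemma dist_sin_le (x y : R) : `|sin x - sin y| <= `|x - y|.
Proof.
wlog xy : x y / y <= x.
  move=> H; have [|/ltW yx] := leP y x; first exact: H.
  by rewrite distrC [leRHS]distrC; exact: H.
rewrite [leRHS]ger0_norm ?subr_ge0// -[leRHS]mul1r.
apply: (dist_le_of_derive (fun x => is_derive_sin x)) => // z _.
by rewrite cos_max.
Qed.

Lemma is_derive_cos_mul (w t : R) :
  is_derive t 1 (fun s => cos (w * s)) (- (w * sin (w * t))).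
Proof.
apply: is_derive_eq.
by rewrite /GRing.scale/= mulr1; ring.
Qed.

Lemma is_derive_sinc_t (w t : R) : is_derive t 1 (sinc_t w) (cos (w * t)).
Proof.
have [->|w0] := eqVneq w 0.
  rewrite mul0r cos0 (_ : sinc_t 0 = id); first exact: is_derive_id.
  by apply/funext => s; rewrite /sinc_t eqxx.
rewrite (_ : sinc_t w = fun s => w^-1 * sin (w * s)); last first.
  by apply/funext => s; rewrite /sinc_t (negbTE w0) mulrC.
apply: is_derive_eq.
by rewrite /GRing.scale/= mulr1; field.
Qed.

Section frequencies.
Variables (w m e t T : R).
Hypotheses (w0 : 0 <= w) (m0 : 0 <= m) (wm : `|w - m| <= e) (t0 : 0 <= t) (tT : t <= T).

Let e0 : 0 <= e. Proof. exact: le_trans wm. Qed.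
Let T0 : 0 <= T. Proof. exact: le_trans tT. Qed.

Lemma dist_cos_mul_le x : 0 <= x <= T -> `|cos (w * x) - cos (m * x)| <= e * T.
Proof.
move=> /andP[x0 xT]; apply: le_trans (dist_cos_le _ _) _.
by rewrite -mulrBl normrM (ger0_norm x0) ler_pM.
Qed.

(** Integrates the cosine estimate in time, as the time derivative of [sinc_t] is a cosine. No
    division by a frequency occurs, so the bound is uniform near frequency zero. *)
Lemma dist_sinc_le : `|sinc_t w t - sinc_t m t| <= e * T ^+ 2.
Proof.
pose f x := sinc_t w x - sinc_t m x.
have fP (x : R) : is_derive x 1 f (cos (w * x) - cos (m * x)).
  exact: is_deriveB (is_derive_sinc_t w x) (is_derive_sinc_t m x).
have := @dist_le_of_derive f _ (e * T) 0 t fP t0.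
have -> : f 0 = 0.
  by rewrite /f /sinc_t !mulr0 sin0 !mul0r; do 2 case: ifP => _; rewrite subrr.
rewrite !subr0 => H; apply: le_trans (H _) _.
  by move=> x /andP[x0 xt]; apply: dist_cos_mul_le; rewrite x0 (le_trans xt).
by rewrite expr2 mulrA ler_wpM2l// mulr_ge0.
Qed.

Lemma dist_mul_sin_le : `|w * sin (w * t) - m * sin (m * t)| <= e * (1 + m * T).
Proof.
rewrite (_ : _ - _ = (w - m) * sin (w * t) + m * (sin (w * t) - sin (m * t))); last by ring.
apply: le_trans (ler_normD _ _) _; rewrite [leRHS]mulrDr mulr1; apply: lerD.
  by rewrite normrM -[leRHS]mulr1 ler_pM// sin_max.
rewrite normrM (ger0_norm m0) mulrCA ler_wpM2l//.
apply: le_trans (dist_sin_le _ _) _.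
by rewrite -mulrBl normrM (ger0_norm t0) ler_pM.
Qed.

End frequencies.

Lemma sqr_le_of_norm_le (x B : R) : `|x| <= B -> x ^+ 2 <= B ^+ 2.
Proof. by move=> xB; rewrite -real_normK ?num_real// lerXn2r// nnegrE (le_trans _ xB). Qed.

Lemma sqr_diff_le (x y B : R) : x ^+ 2 <= B -> y ^+ 2 <= B -> (x - y) ^+ 2 <= 4 * B.
Proof. by move=> xB yB; have := sqr_ge0 (x + y); nra. Qed.

Lemma sqr_cos_le1 (x : R) : cos x ^+ 2 <= 1.
Proof. by rewrite -(cos2Dsin2 x) lerDl sqr_ge0. Qed.

Lemma sqr_sin_le1 (x : R) : sin x ^+ 2 <= 1.
Proof. by rewrite -(cos2Dsin2 x) lerDr sqr_ge0. Qed.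

Lemma sqr_sinc_le (w t B : R) : 0 < B -> B <= w ^+ 2 -> sinc_t w t ^+ 2 <= B^-1.
Proof.
move=> B0 Bw; have w20 : 0 < w ^+ 2 by exact: lt_le_trans Bw.
have wn0 : w != 0 by apply: contraTneq w20 => ->; rewrite expr0n ltxx.
rewrite /sinc_t (negbTE wn0) expr_div_n; apply: (@le_trans _ _ (w ^+ 2)^-1).
  by rewrite -[leRHS]mul1r ler_wpM2r ?invr_ge0 ?(ltW w20)// sqr_sin_le1.
by rewrite lef_pV2.
Qed.

Variable d : nat.
Implicit Types (F u v : cfield R d) (xi : d.-tuple R).

Definition sqr_mod F xi : R := \sum_(i < d) ((F i xi).1 ^+ 2 + (F i xi).2 ^+ 2).

Lemma sqr_mod_ge0 F xi : 0 <= sqr_mod F xi.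
Proof. by apply: sumr_ge0 => i _; rewrite addr_ge0 ?sqr_ge0. Qed.

Definition jbracket2 xi : R := 1 + enorm xi ^+ 2.

Lemma jbracket2_ge1 xi : 1 <= jbracket2 xi.
Proof. by rewrite lerDl sqr_ge0. Qed.

Lemma jbracket2_gt0 xi : 0 < jbracket2 xi.
Proof. exact: lt_le_trans (jbracket2_ge1 xi). Qed.

(** The integrable majorant of the whole argument: the weighted densities of both data, finite in
    total by hypothesis on them. *)
Definition data_density (s a : R) u v xi : R :=
  jbracket2 xi `^ s * sqr_mod u xi + jbracket2 xi `^ (s - a) * sqr_mod v xi.

Lemma data_density_ge0 s a u v xi : 0 <= data_density s a u v xi.
Proof. by rewrite addr_ge0 ?mulr_ge0 ?powR_ge0 ?sqr_mod_ge0. Qed.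

(** Solutions, their time derivatives and differences of these all have this shape, so a single
    weighted estimate serves for all of them. *)
Definition comb_field (p q : d.-tuple R -> R) u v : cfield R d :=
  fun i xi => (p xi * (u i xi).1 + q xi * (v i xi).1, p xi * (u i xi).2 + q xi * (v i xi).2).

Lemma sqr_mod_comb_le (p q : d.-tuple R -> R) u v xi :
  sqr_mod (comb_field p q u v) xi <=
  2 * (p xi ^+ 2 * sqr_mod u xi + q xi ^+ 2 * sqr_mod v xi).
Proof.
rewrite /sqr_mod !mulr_sumr -big_split/= mulr_sumr; apply: ler_sum => i _.
move: (p xi) (q xi) (u i xi) (v i xi) => a b [x x'] [y y'] /=.
have := sqr_ge0 (a * x - b * y); have := sqr_ge0 (a * x' - b * y').
nra.
Qed.

Lemma comb_density_le (s a sg B : R) (p q : d.-tuple R -> R) u v xi :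
  jbracket2 xi `^ sg * p xi ^+ 2 <= B * jbracket2 xi `^ s ->
  jbracket2 xi `^ sg * q xi ^+ 2 <= B * jbracket2 xi `^ (s - a) ->
  jbracket2 xi `^ sg * sqr_mod (comb_field p q u v) xi <= 2 * B * data_density s a u v xi.
Proof.
move=> pB qB; have J0 := powR_ge0 (jbracket2 xi) sg.
apply: le_trans (ler_wpM2l J0 (sqr_mod_comb_le p q u v xi)) _.
have := ler_wpM2r (sqr_mod_ge0 u xi) pB; have := ler_wpM2r (sqr_mod_ge0 v xi) qB.
rewrite /data_density; nra.
Qed.

Lemma diff_field_comb (p q p' q' : d.-tuple R -> R) u v :
  diff_field (comb_field p q u v) (comb_field p' q' u v) =
  comb_field (fun xi => p xi - p' xi) (fun xi => q xi - q' xi) u v.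
Proof.
by apply/funext => i; apply/funext => xi; rewrite /diff_field /comb_field/=; congr pair; ring.
Qed.

Lemma msol_comb (w : d.-tuple R -> R) u v t :
  msol w u v t = comb_field (fun xi => cos (w xi * t)) (fun xi => sinc_t (w xi) t) u v.
Proof. by []. Qed.

Lemma dt_msol_comb (w : d.-tuple R -> R) u v t :
  dt_field (msol w u v) t =
  comb_field (fun xi => - (w xi * sin (w xi * t))) (fun xi => cos (w xi * t)) u v.
Proof.
have D (z x y : R) : derive1 (fun r => cos (z * r) * x + sinc_t z r * y) t =
    - (z * sin (z * t)) * x + cos (z * t) * y.
  rewrite derive1E (_ : (fun _ => _) = (x \*: (fun r => cos (z * r))) + (y \*: sinc_t z)).
    have := is_deriveD (is_deriveZ x (is_derive_cos_mul z t)) (is_deriveZ y (is_derive_sinc_t z t)).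
    by move=> H; rewrite (@derive_val _ _ _ _ _ _ _ H) /GRing.scale/= mulrC [y * _]mulrC.
  by apply/funext => r /=; rewrite mulrC [_ * y]mulrC.
apply/funext => i; apply/funext => xi; rewrite /dt_field /comb_field /msol/=.
by congr pair; exact: D.
Qed.

End multipliers.

(** * Pointwise estimates at low and high frequencies *)

Section pointwise_estimates.
Variables (R : realType) (d : nat) (gam alpha c : R) (w : R -> d.-tuple R -> R).
Hypotheses (alpha_gt0 : 0 < alpha) (alpha_lt1 : alpha < 1) (gam_ge0 : 0 <= gam) (c_gt0 : 0 < c).
Hypothesis w_ge0 : forall delta xi, 0 <= w delta xi.
Hypothesis w_le : forall delta xi, 0 < delta -> w delta xi <= gam * enorm xi.
Hypothesis w_ge_small : forall delta xi, 0 < delta -> delta * enorm xi <= 1 ->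
  (gam * enorm xi) ^+ 2 * (1 - (delta * enorm xi) ^+ 2 / 12) <= w delta xi ^+ 2.
Hypothesis w_ge_large : forall delta xi, 0 < delta <= 1 -> 1 <= enorm xi ->
  c * enorm xi `^ (2 * alpha) <= w delta xi ^+ 2.
Variables (s T : R) (u v : cfield R d).
Hypothesis T_ge0 : 0 <= T.

Local Notation m := (fun xi : d.-tuple R => gam * enorm xi).
Local Notation J := (@jbracket2 R d).
Local Notation W := (data_density s alpha u v).

Let m_ge0 xi : 0 <= m xi. Proof. by rewrite mulr_ge0// enorm_ge0. Qed.

Lemma dist_freq_le delta N xi : 0 < delta -> delta * N <= 1 -> enorm xi <= N ->
  `|w delta xi - gam * enorm xi| <= gam * N ^+ 2 * delta.
Proof.
move=> delta0 dN xiN; have xi0 := enorm_ge0 xi.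
have N0 : 0 <= N by exact: le_trans xiN.
have dxiN : delta * enorm xi <= delta * N by rewrite ler_wpM2l// ltW.
have dxi : delta * enorm xi <= 1 by exact: le_trans dN.
have dxi0 : 0 <= delta * enorm xi by rewrite mulr_ge0// ltW.
have dxi2 : (delta * enorm xi) ^+ 2 <= delta * N by rewrite expr2; nra.
set e := (delta * enorm xi) ^+ 2 / 12.
have e0 : 0 <= e by rewrite divr_ge0// sqr_ge0.
have e1 : e <= delta * N by rewrite /e; have := sqr_ge0 (delta * enorm xi); lra.
have e2 : e <= 2^-1 by rewrite /e; lra.
(* The bound on [w^2] passes to [w] without a square root, since [(1 - e)^2 <= 1 - e] for
   [0 <= e <= 1]. *)
have wge : gam * enorm xi * (1 - e) <= w delta xi.
  rewrite -ler_sqr ?nnegrE ?w_ge0//; last first.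
    by rewrite mulr_ge0 ?m_ge0// subr_ge0; exact: le_trans dN.
  apply: le_trans (w_ge_small delta0 dxi); rewrite exprMn ler_wpM2l ?sqr_ge0//.
  by rewrite -/e expr2 ger_pMr; lra.
rewrite distrC ger0_norm ?subr_ge0 ?w_le//.
apply: (@le_trans _ _ (gam * enorm xi * e)); first by lra.
rewrite (_ : gam * N ^+ 2 * delta = gam * N * (delta * N)); last by ring.
by rewrite ler_pM ?m_ge0// ler_wpM2l.
Qed.

Let J_pos xi : 0 < J xi. Proof. exact: jbracket2_gt0. Qed.

Let J_pow xi a b : J xi `^ (a + b) = J xi `^ a * J xi `^ b.
Proof. by rewrite powRD// (gt_eqF (J_pos xi)) implybT. Qed.

Let J_pow_ge0 xi a : 0 <= J xi `^ a. Proof. exact: powR_ge0. Qed.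

Let J_pow_s xi : J xi `^ s = J xi `^ (s - alpha) * J xi `^ alpha.
Proof. by rewrite -J_pow subrK. Qed.

Let J_powB1_le xi a : s - 1 <= a -> J xi `^ (s - 1) <= J xi `^ a.
Proof. by move=> ?; rewrite ler_powR// jbracket2_ge1. Qed.

Section low_frequencies.
Variable N : R.
Hypothesis N_ge1 : 1 <= N.
Let E := gam * N ^+ 2.
Let L := (1 + N ^+ 2) `^ alpha.

Let E_ge0 : 0 <= E. Proof. by rewrite mulr_ge0// sqr_ge0. Qed.

Lemma low_sol : exists2 K, 0 <= K & forall delta t xi, 0 < delta -> delta * N <= 1 ->
  0 <= t <= T -> enorm xi <= N ->
  J xi `^ s * sqr_mod (diff_field (msol (w delta) u v t) (msol m u v t)) xi
    <= K * delta * W xi.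
Proof.
have L0 : 0 <= L by exact: powR_ge0.
(* The frequencies are [E * delta]-close; the squared cosine and sinc errors bring [T ^+ 2] and
   [T ^+ 4]. The factor [L] bounds the missing weight [J^alpha] of [v] on [|xi| <= N]. *)
exists (2 * (E ^+ 2 * (T ^+ 2 + T ^+ 4 * L))).
  apply: mulr_ge0 => //; apply: mulr_ge0; first exact: sqr_ge0.
  by apply: addr_ge0; [exact: sqr_ge0|apply: mulr_ge0 => //; exact: exprn_ge0].
move=> delta t xi delta0 dN /andP[t0 tT] xiN.
have delta1 : delta <= 1 by apply: le_trans dN; rewrite ler_peMr// ltW.
have wm := dist_freq_le delta0 dN xiN; rewrite -/E in wm.
(* As [delta <= 1], one power of [delta] is given up to make the majorant linear in [delta]. *)
have d2 : (E * delta) ^+ 2 <= E ^+ 2 * delta.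
  by rewrite exprMn ler_wpM2l ?sqr_ge0// expr2 ger_pMr.
rewrite !msol_comb diff_field_comb.
rewrite [leRHS](_ : _ = 2 * (E ^+ 2 * delta * (T ^+ 2 + T ^+ 4 * L)) * W xi); last by ring.
have Ed0 : 0 <= E ^+ 2 * delta by rewrite mulr_ge0 ?sqr_ge0// ltW.
apply: comb_density_le.
- rewrite mulrC ler_wpM2r//.
  have tTT : 0 <= t <= T by rewrite t0.
  apply: le_trans (sqr_le_of_norm_le (dist_cos_mul_le wm tTT)) _.
  rewrite exprMn; apply: ler_pM; rewrite ?sqr_ge0// lerDl.
  by apply: mulr_ge0 => //; exact: exprn_ge0.
- have H := sqr_le_of_norm_le (dist_sinc_le wm t0 tT).
  have JL : J xi `^ alpha <= L.
    apply: ge0_ler_powR; rewrite ?nnegrE ?(ltW alpha_gt0) ?addr_ge0 ?sqr_ge0//.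
    by rewrite lerD2l ler_sqr ?nnegrE ?enorm_ge0// (le_trans ler01).
  rewrite J_pow_s -mulrA mulrC ler_wpM2r//.
  apply: le_trans (ler_pM (J_pow_ge0 _ _) (sqr_ge0 _) JL H) _.
  rewrite exprMn -exprM mulrCA; apply: ler_pM; rewrite ?sqr_ge0 ?mulr_ge0 ?exprn_ge0//.
  by rewrite mulrC lerDr sqr_ge0.
Qed.

Lemma low_dt : exists2 K, 0 <= K & forall delta t xi, 0 < delta -> delta * N <= 1 ->
  0 <= t <= T -> enorm xi <= N ->
  J xi `^ (s - 1) * sqr_mod (diff_field (dt_field (msol (w delta) u v) t)
    (dt_field (msol m u v) t)) xi <= K * delta * W xi.
Proof.
pose M := 1 + gam * N * T.
have M0 : 0 <= M by rewrite addr_ge0// !mulr_ge0// (le_trans ler01).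
exists (2 * (E ^+ 2 * (M ^+ 2 + T ^+ 2))).
  apply: mulr_ge0 => //; apply: mulr_ge0; first exact: sqr_ge0.
  by apply: addr_ge0; exact: sqr_ge0.
move=> delta t xi delta0 dN /andP[t0 tT] xiN.
have delta1 : delta <= 1 by apply: le_trans dN; rewrite ler_peMr// ltW.
have wm := dist_freq_le delta0 dN xiN; rewrite -/E in wm.
have d2 : (E * delta) ^+ 2 <= E ^+ 2 * delta.
  by rewrite exprMn ler_wpM2l ?sqr_ge0// expr2 ger_pMr.
rewrite !dt_msol_comb diff_field_comb.
rewrite [leRHS](_ : _ = 2 * (E ^+ 2 * delta * (M ^+ 2 + T ^+ 2)) * W xi); last by ring.
have Ed0 : 0 <= E ^+ 2 * delta by rewrite mulr_ge0 ?sqr_ge0// ltW.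
apply: comb_density_le.
- rewrite mulrC; apply: ler_pM; rewrite ?sqr_ge0//; last by apply: J_powB1_le; rewrite gerBl.
  have := dist_mul_sin_le (m_ge0 xi) wm t0 tT => H.
  have {}H : `|w delta xi * sin (w delta xi * t) - m xi * sin (m xi * t)| <= E * delta * M.
    apply: le_trans H _; apply: ler_wpM2l; first by rewrite mulr_ge0// ltW.
    by rewrite /M lerD2l; apply: ler_wpM2r => //; exact: ler_wpM2l.
  have {}H := sqr_le_of_norm_le H.
  rewrite -opprD sqrrN; apply: le_trans H _.
  by rewrite exprMn; apply: ler_pM; rewrite ?sqr_ge0// lerDl sqr_ge0.
- rewrite mulrC; apply: ler_pM; rewrite ?sqr_ge0//; last by apply: J_powB1_le; rewrite lerD2l lerN2 ltW.
  have tTT : 0 <= t <= T by rewrite t0.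
  apply: le_trans (sqr_le_of_norm_le (dist_cos_mul_le wm tTT)) _.
  by rewrite exprMn; apply: ler_pM; rewrite ?sqr_ge0// lerDr sqr_ge0.
Qed.

End low_frequencies.

Lemma high_sol delta t xi : 0 < delta <= 1 -> 1 <= enorm xi ->
  J xi `^ s * sqr_mod (diff_field (msol (w delta) u v t) (msol m u v t)) xi
    <= (8 + 16 / c) * W xi.
Proof.
move=> delta01 xi1; have /andP[delta0 _] := delta01.
have xi0 : 0 < enorm xi by exact: lt_le_trans xi1.
have cV : 0 < c^-1 by rewrite invr_gt0.
rewrite !msol_comb diff_field_comb.
(* The [4] bounds the squared difference of two cosines; [8 / c] is [4 / (c |xi|^(2 alpha))] for the
   sincs times [J^alpha <= 2 |xi|^(2 alpha)]. *)
rewrite (_ : 8 + 16 / c = 2 * (4 + 8 / c)); last by ring.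
apply: comb_density_le.
  rewrite mulrC ler_wpM2r//.
  have := sqr_diff_le (sqr_cos_le1 (w delta xi * t)) (sqr_cos_le1 (m xi * t)); lra.
rewrite J_pow_s -mulrA mulrC ler_wpM2r//.
have P0 : 0 < enorm xi `^ (2 * alpha) by rewrite powR_gt0.
have B0 : 0 < c * enorm xi `^ (2 * alpha) by rewrite mulr_gt0.
have wB := w_ge_large delta01 xi1.
(* The wave frequency inherits the lower bound because it dominates [w]. *)
have mB : c * enorm xi `^ (2 * alpha) <= m xi ^+ 2.
  by apply: le_trans wB _; rewrite ler_sqr ?nnegrE ?m_ge0 ?w_ge0// w_le.
have H := sqr_diff_le (sqr_sinc_le t B0 wB) (sqr_sinc_le t B0 mB).
have JP : J xi `^ alpha <= 2 * enorm xi `^ (2 * alpha).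
  rewrite powRrM powR_mulrn ?enorm_ge0//.
  apply: (@le_trans _ _ ((2 * enorm xi ^+ 2) `^ alpha)).
    apply: ge0_ler_powR; rewrite ?nnegrE ?(ltW alpha_gt0) ?(ltW (J_pos _))//.
      by rewrite mulr_ge0// sqr_ge0.
    have : 1 <= enorm xi ^+ 2 by rewrite expr_ge1 ?enorm_ge0.
    by rewrite /jbracket2; lra.
  rewrite powRM ?sqr_ge0// ler_wpM2r ?powR_ge0// ler1_powR ?ltW//.
  by rewrite ltr1n.
apply: le_trans (ler_pM (J_pow_ge0 _ _) (sqr_ge0 _) JP H) _.
rewrite (_ : _ * _ = 8 / c); first by lra.
by field; rewrite !gt_eqF.
Qed.

Lemma high_dt delta t xi : 0 < delta <= 1 ->
  J xi `^ (s - 1) * sqr_mod (diff_field (dt_field (msol (w delta) u v) t)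
    (dt_field (msol m u v) t)) xi <= (8 * gam ^+ 2 + 8) * W xi.
Proof.
move=> /andP[delta0 _].
rewrite !dt_msol_comb diff_field_comb.
rewrite (_ : 8 * gam ^+ 2 + 8 = 2 * (4 * gam ^+ 2 + 4)); last by ring.
apply: comb_density_le.
  have ms : (- (m xi * sin (m xi * t))) ^+ 2 <= m xi ^+ 2.
    by rewrite sqrrN exprMn ler_piMr ?sqr_ge0// sqr_sin_le1.
  have ws : (- (w delta xi * sin (w delta xi * t))) ^+ 2 <= m xi ^+ 2.
    rewrite sqrrN exprMn; apply: (@le_trans _ _ (w delta xi ^+ 2)).
      by rewrite ler_piMr ?sqr_ge0// sqr_sin_le1.
    by rewrite ler_sqr ?nnegrE ?m_ge0 ?w_ge0// w_le.
  have H := sqr_diff_le ws ms.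
  (* The squared frequency [gam^2 |xi|^2] is paid for by one power of [J], exactly the gap between
     [H^(s-1)] and [H^s]. *)
  have -> : J xi `^ s = J xi `^ (s - 1) * J xi.
    by rewrite -[X in _ * X](powRr1 (ltW (J_pos xi))) -J_pow subrK.
  rewrite [leRHS]mulrCA ler_wpM2l//.
  apply: le_trans H _; rewrite exprMn /jbracket2.
  by have := sqr_ge0 (enorm xi); have := sqr_ge0 gam; nra.
rewrite mulrC; apply: ler_pM; rewrite ?sqr_ge0//; last by apply: J_powB1_le; rewrite lerD2l lerN2 ltW.
have := sqr_diff_le (sqr_cos_le1 (w delta xi * t)) (sqr_cos_le1 (m xi * t)).
have := sqr_ge0 gam; lra.
Qed.

(** The order of quantifiers matters: [C] is independent of the cutoff [N], while [K] may grow with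
    it. Hence [N] can be fixed from the tail before [delta] is made small. *)
Lemma density_diff_le : exists2 C, 0 <= C & forall N, 1 <= N -> exists2 K, 0 <= K &
  forall delta t xi, 0 < delta -> delta * N <= 1 -> 0 <= t <= T ->
  J xi `^ s * sqr_mod (diff_field (msol (w delta) u v t) (msol m u v t)) xi
    <= (K * delta + C * (N < enorm xi)%R%:R) * W xi /\
  J xi `^ (s - 1) * sqr_mod (diff_field (dt_field (msol (w delta) u v) t)
    (dt_field (msol m u v) t)) xi <= (K * delta + C * (N < enorm xi)%R%:R) * W xi.
Proof.
have cV : 0 < c^-1 by rewrite invr_gt0.
have g2 := sqr_ge0 gam.
have W0 xi : 0 <= W xi by exact: data_density_ge0.
exists (8 + 16 / c + (8 * gam ^+ 2 + 8)); first by lra.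
move=> N N1; have [K1 K10 HK1] := low_sol N1; have [K2 K20 HK2] := low_dt N1.
exists (K1 + K2) => [|delta t xi delta0 dN tT]; first exact: addr_ge0.
have delta01 : 0 < delta <= 1.
  by rewrite delta0; apply: le_trans dN; rewrite ler_peMr// ltW.
have [xiN|xiN] := leP (enorm xi) N.
  rewrite mulr0 addr0; split.
    apply: le_trans (HK1 _ _ _ delta0 dN tT xiN) _.
    by rewrite ler_wpM2r// ler_wpM2r ?lerDl// ltW.
  apply: le_trans (HK2 _ _ _ delta0 dN tT xiN) _.
  by rewrite ler_wpM2r// ler_wpM2r ?lerDr// ltW.
have xi1 : 1 <= enorm xi by exact: ltW (le_lt_trans N1 xiN).
have K0 : 0 <= (K1 + K2) * delta by rewrite mulr_ge0 ?addr_ge0// ltW.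
rewrite mulr1; split.
  apply: le_trans (high_sol _ delta01 xi1) _; rewrite ler_wpM2r//; lra.
by apply: le_trans (high_dt _ _ delta01) _; rewrite ler_wpM2r//; lra.
Qed.

End pointwise_estimates.

(** * Tails of integrals and passage to the limit *)

Section convergence.
Variables (R : realType) (d : nat).

(** By monotone convergence the mass in balls of integer radius tends to the finite total, so the
    mass outside becomes small. *)
Lemma intRd_tail (f : d.-tuple R -> R) : measurable_fun setT f -> (forall x, 0 <= f x) ->
  (intRd (fun x => (f x)%:E) < +oo)%E -> forall e, 0 < e -> exists2 N : R, 1 <= N &
  (intRd (fun x : d.-tuple R => ((N < enorm x)%R%:R * f x)%:E) <= e%:E)%E.
Proof.
move=> mf f0 foo e e0.
pose g (N : nat) x : R := (enorm x <= N%:R)%R%:R * f x.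
pose h (N : nat) x : R := (N%:R < enorm x)%R%:R * f x.
have mn := @measurable_enorm R d.
have mg N : measurable_fun setT (g N).
  by apply: measurable_funM => //; apply: measurable_boolr; exact: measurable_fun_ler.
have mh N : measurable_fun setT (h N).
  by apply: measurable_funM => //; apply: measurable_boolr; exact: measurable_fun_ltr.
have g0 N x : 0 <= g N x by rewrite mulr_ge0.
have h0 N x : 0 <= h N x by rewrite mulr_ge0.
have gh N : (intRd (fun x => (f x)%:E) =
    intRd (fun x => (g N x)%:E) + intRd (fun x => (h N x)%:E))%E.
  rewrite -intRdD//; apply: eq_intRd => x; rewrite /g /h; congr (_%:E).
  by case: leP => _; rewrite mul1r mul0r ?addr0 ?add0r.
have fE : intRd (fun x => (f x)%:E) = (fine (intRd (fun x => (f x)%:E)))%:E.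
  by rewrite fineK// ge0_fin_numE// intRd_ge0// => x; rewrite lee_fin.
set A := fine _ in fE.
have gA N : (intRd (fun x => (g N x)%:E) <= A%:E)%E.
  rewrite -fE; apply: le_intRd => x; rewrite lee_fin// /g.
  by case: (enorm x <= _); rewrite ?mul1r ?mul0r.
have gfin N : intRd (fun x => (g N x)%:E) \is a fin_num.
  rewrite ge0_fin_numE; last by apply: intRd_ge0 => x; rewrite lee_fin.
  by apply: le_lt_trans (gA N) _; rewrite ltry.
have cvg_g : fine (intRd (fun x => (g N x)%:E)) @[N --> \oo] --> A.
  apply: fine_cvg; rewrite -fE.
  rewrite (intRdE_EFin mf f0) (eq_integral (fun x => limn (fun N => (g N x)%:E))); last first.
    move=> x _; apply/esym/cvg_lim => //; apply: cvg_near_cst.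
    exists (Num.truncn (enorm x)).+1 => // N /= xN.
    rewrite /g (_ : enorm x <= N%:R) ?mul1r//.
    by apply: ltW; apply: lt_le_trans (truncnS_gt _) _; rewrite ler_nat.
  rewrite (_ : (fun N => _) = fun N => (\int[leb R d]_x (g N x)%:E)%E); last first.
    by apply/funext => N; rewrite intRdE_EFin.
  apply: cvg_monotone_convergence => //.
  - by move=> N; exact/measurable_EFinP.
  - by move=> N x _; rewrite lee_fin.
  - move=> x _ m n mn'; rewrite lee_fin /g ler_wpM2r// ler_nat.
    have [xm|//] := leP (enorm x) m%:R.
    by rewrite (le_trans xm)// ler_nat.
have Ae : A - e < A by rewrite gtrBl.
have [N [N1 Ng]] := filter_ex (filterI (nbhs_infty_ge 1) (cvgr_gt _ cvg_g _ Ae)).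
exists N%:R; first by rewrite ler1n.
have := gh N; rewrite fE -(fineK (gfin N)) => AE.
have hN : (intRd (fun x => (h N x)%:E) = (A - fine (intRd (fun x => (g N x)%:E)))%:E)%E.
  by rewrite EFinB AE addeAC subee// add0e.
rewrite -/(h N) hN lee_fin; lra.
Qed.

Lemma Hs_norm_le (s B : R) (F : cfield R d) :
  (Hs_norm2 s F <= B%:E)%E -> (Hs_norm s F <= (Num.sqrt B)%:E)%E.
Proof. by rewrite /Hs_norm; case: (Hs_norm2 s F) => [r| |]//=; rewrite !lee_fin => /ler_wsqrtr. Qed.

Lemma Hs_norm_ge0 (s : R) (F : cfield R d) : (0 <= Hs_norm s F)%E.
Proof.
exact: sqrte_ge0.
Qed.

Lemma measurable_Hs_density (s : R) (F : cfield R d) : in_Hs_hat s F ->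
  measurable_fun setT (fun xi => jbracket2 xi `^ s * sqr_mod F xi).
Proof.
move=> [m1 m2 _ _]; apply: measurable_funM.
  apply: (measurableT_comp (@measurable_powR R s)); apply: measurable_funD => //.
  by apply: measurable_funX; exact: measurable_enorm.
by apply: measurable_sum => i; apply: measurable_funD; exact: measurable_funX.
Qed.

Lemma cvge0_of_near_le (T : Type) (F : set_system T) {FF : ProperFilter F} (f : T -> \bar R) :
  (\forall x \near F, (0 <= f x)%E) ->
  (forall e : R, 0 < e -> \forall x \near F, (f x <= e%:E)%E) -> f @ F --> 0%E.
Proof.
move=> f0 fe; apply/fine_cvgP; split.
  near=> x; rewrite ge0_fin_numE; last by near: x.
  by apply: (@le_lt_trans _ _ 1%:E); [near: x; exact: fe|exact: ltry].
apply/cvgr0Pnorm_le => e e0; near=> x.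
have x0 : (0 <= f x)%E by near: x.
have xe : (f x <= e%:E)%E by near: x; exact: fe.
rewrite ger0_norm ?fine_ge0//=.
by rewrite -lee_fin fineK// ge0_fin_numE// (le_lt_trans xe)// ltry.
Unshelve. all: by end_near. Qed.

End convergence.

Unset Implicit Arguments.

Theorem theorem1p3 (R : realType) (d : nat) (kappa alpha : R) (chi : R -> R)
  (s : R) (u0hat v0hat : cfield R d) :
  (1 <= d)%N -> 0 < kappa -> 0 < alpha < 1 ->
  measurable_fun setT chi ->
  (forall r, 0 <= chi r <= 1) ->
  (forall r, 1 < `|r| -> chi r = 0) ->
  (forall r, `|r| <= 2^-1 -> chi r = 1) ->
  in_Hs_hat s u0hat -> in_Hs_hat (s - alpha) v0hat ->
  let gam := gamma_const d kappa alpha chi in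
  let udelta := fun delta t => msol (omega kappa alpha chi delta) u0hat v0hat t in
  let u := fun t => msol (fun xi => gam * enorm xi) u0hat v0hat t in
  forall T : R, 0 <= T ->
  (ereal_sup [set (Hs_norm s (diff_field (udelta delta t) (u t))
                   + Hs_norm (s - 1) (diff_field (dt_field (udelta delta) t)
                                                 (dt_field u t)))%E
              | t in `[0, T]]) @[delta --> 0^'+] --> 0%E.
Proof.
move=> d0 kappa0 /andP[alpha0 alpha1] mchi chi01 chi_out chi_in u0P v0P gam udelta u T T0.
have [c c0 large] := omega_ge_large d0 kappa0 alpha1 mchi chi01 chi_out chi_in.
have small := omega_ge_small d0 kappa0 alpha1 mchi chi01 chi_out.
have upper := omega_le d0 kappa0 alpha1 mchi chi01 chi_out.
have gam0 := gamma_const_ge0 d kappa alpha chi.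
have [C C0 HC] := density_diff_le alpha0 alpha1 gam0 c0 (omega_ge0 kappa alpha chi)
  upper small large s u0hat v0hat T0.
pose W := data_density s alpha u0hat v0hat.
have W0 xi : 0 <= W xi by exact: data_density_ge0.
have mu := measurable_Hs_density u0P; have mv := measurable_Hs_density v0P.
have mW : measurable_fun setT W by exact: measurable_funD.
have Wfin : (intRd (fun xi => (W xi)%:E) < +oo)%E.
  rewrite intRdD//.
  - by apply: lte_add_pinfty; [have [_ _ _] := u0P|have [_ _ _] := v0P].
  - by move=> xi; rewrite mulr_ge0 ?powR_ge0 ?sqr_mod_ge0.
  - by move=> xi; rewrite mulr_ge0 ?powR_ge0 ?sqr_mod_ge0.
have WE : intRd (fun xi => (W xi)%:E) = (fine (intRd (fun xi => (W xi)%:E)))%:E.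
  by rewrite fineK// ge0_fin_numE// intRd_ge0// => x; rewrite lee_fin.
set A := fine _ in WE.
have A0 : 0 <= A by rewrite -lee_fin -WE intRd_ge0// => x; rewrite lee_fin.
apply: cvge0_of_near_le => [|e e0].
  (* An empty supremum would be [-oo]; time [0] belongs to the interval and witnesses
     nonnegativity. *)
  near=> delta; apply: (@le_trans _ _ (Hs_norm s (diff_field (udelta delta 0%R) (u 0%R))
    + Hs_norm (s - 1) (diff_field (dt_field (udelta delta) 0%R) (dt_field u 0%R)))%E).
    by rewrite adde_ge0 ?Hs_norm_ge0.
  by apply: ereal_sup_ubound; exists 0 => //=; rewrite in_itv/= lexx.
(* Each of the two norms may use [e / 2], so its square may use [eta], half for each of the two
   terms of the majorant. *)
pose eta := (e / 2) ^+ 2.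
have eta0 : 0 < eta by rewrite exprn_gt0// divr_gt0.
(* The added [1] keeps the denominator positive when [C = 0]; likewise for [K * A + 1] below. *)
have C10 : 0 < 2 * (C + 1) by rewrite mulr_gt0// ltr_wpDl.
have [N N1 tailN] := intRd_tail mW W0 Wfin (divr_gt0 eta0 C10).
have N0 : 0 < N by exact: lt_le_trans N1.
have [K K0 HK] := HC N N1.
have KA0 : 0 <= K * A by rewrite mulr_ge0.
have KA10 : 0 < 2 * (K * A + 1) by rewrite mulr_gt0// ltr_wpDl.
near=> delta.
have delta0 : 0 < delta by near: delta; exact: nbhs_right_gt.
have dN : delta * N <= 1.
  rewrite -ler_pdivlMr// mul1r; near: delta; apply: nbhs_right_le; by rewrite invr_gt0.
have dK : delta <= eta / (2 * (K * A + 1)).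
  by near: delta; apply: nbhs_right_le; exact: divr_gt0.
have bound (sg : R) (F : cfield R d) :
    (forall xi, jbracket2 xi `^ sg * sqr_mod F xi <=
      (K * delta + C * (N < enorm xi)%R%:R) * W xi) ->
    (Hs_norm sg F <= (e / 2)%:E)%E.
  move=> FW; rewrite -[e / 2]ger0_norm ?divr_ge0 ?(ltW e0)// -sqrtr_sqr -/eta.
  apply: Hs_norm_le.
  (* The density containing [omega] is replaced by one built from [W] alone, whose measurability is
     known; additivity is applied only after that. *)
  apply: (@le_trans _ _ (intRd (fun xi => (K * delta * W xi + C * ((N < enorm xi)%R%:R * W xi))%:E))).
    apply: le_intRd => xi; rewrite lee_fin; first by rewrite mulr_ge0 ?powR_ge0 ?sqr_mod_ge0.
    by apply: le_trans (FW xi) _; rewrite mulrDl mulrA.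
  have mNW : measurable_fun setT (fun xi : d.-tuple R => (N < enorm xi)%R%:R * W xi).
    apply: measurable_funM => //; apply: measurable_boolr.
    by apply: measurable_fun_ltr => //; exact: measurable_enorm.
  have Kd0 : 0 <= K * delta by rewrite mulr_ge0// ltW.
  rewrite intRdD//; first last.
  - by move=> xi; rewrite !mulr_ge0.
  - by move=> xi; rewrite mulr_ge0.
  - exact: measurable_funM.
  - exact: measurable_funM.
  rewrite (intRdZ Kd0 mW W0) intRdZ// => [|xi]; last by rewrite mulr_ge0.
  rewrite WE -EFinM.
  apply: (@le_trans _ _ ((K * delta * A)%:E + C%:E * (eta / (2 * (C + 1)))%:E)%E).
    by rewrite leeD2l// lee_wpmul2l// lee_fin.
  rewrite -EFinM -EFinD lee_fin.
  have h1 : K * delta * A <= eta / 2.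
    rewrite mulrAC; apply: le_trans (ler_wpM2l KA0 dK) _.
    rewrite [leLHS](_ : _ = eta / 2 * (K * A / (K * A + 1))); last by field; rewrite gt_eqF// ltr_wpDl.
    rewrite ler_piMr ?divr_ge0 ?(ltW eta0)// ler_pdivrMr ?mul1r ?lerDl// ltr_wpDl//.
  have h2 : C * (eta / (2 * (C + 1))) <= eta / 2.
    rewrite [leLHS](_ : _ = eta / 2 * (C / (C + 1))); last by field; rewrite gt_eqF// ltr_wpDl.
    rewrite ler_piMr ?divr_ge0 ?(ltW eta0)// ler_pdivrMr ?mul1r ?lerDl// ltr_wpDl//.
  lra.
apply: ge_ereal_sup => _ [t tT <-].
have t0T : 0 <= t <= T by move: tT; rewrite /= in_itv.
rewrite [e]splitr EFinD; apply: leeD; apply: bound => xi.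
  by have [] := HK delta t xi delta0 dN t0T.
by have [] := HK delta t xi delta0 dN t0T.
Unshelve. all: by end_near. Qed.
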